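(* Let $G$ be a finite simple bipartite graph such that $R=K[G]$ is inseparable. Then the following statements are equivalent: (a) $K[G]$ is not semi-rigid; (b) there exist edges $e,f$ of $G$ and an induced cycle $C$ of $G$ such that $e,f$ have the same parity in $C$ and such that for any other induced cycle $C'$ of $G$, $e\in E(C')$ if and only if $f\in E(C')$.
   Context: $K$ is a field of characteristic $0$. $G$ has vertex set $[m]$ and edges $e_1,\ldots,e_n$; $\delta_1,\ldots,\delta_m$ is the canonical basis of $\mathbb{Z}^m$, $h_k=\delta_i+\delta_j$ for $e_k=\{i,j\}$, $H$ is the semigroup (containing $0$) generated by $h_1,\ldots,h_n$, $\mathbb{Z}H$ the group it generates, and $R=K[G]=K[H]=K[t_it_j:\{i,j\}\in E(G)]$ is the edge ring. $L\subset\mathbb{Z}^n$ is the relation lattice, the kernel of $\mathbb{Z}^n\to\mathbb{Z}^m$, $\epsilon_k\mapsto h_k$. An induced cycle is a cycle without a chord. If $C$ is a cycle with edges $e_{i_1},\ldots,e_{i_{2t}}$ labeled consecutively around the cycle, two distinct edges $e=e_{i_j}$, $e'=e_{i_k}$ of $C$ have the same parity in $C$ if $j-k$ is even. $R$ is semi-rigid if $T^1(R)_a=0$ for all $a\in\mathbb{Z}H$ with $-a\in H$. Definition of $T^1$: for $v\in\mathbb{Z}^n$ put $f_v=\prod_{v(i)\ge0}x_i^{v(i)}-\prod_{v(i)\le0}x_i^{-v(i)}$ in $S=K[x_1,\ldots,x_n]$ and for $v\in L$ put $h(v)=\sum_{v(i)\ge0}v(i)h_i$. Let $\bigoplus_iR\,dx_i$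 be the free graded $R$-module with $\deg dx_i=h_i$, and $U$ its submodule generated by $df_v=\sum_iv(i)t^{h(v)-h_i}dx_i$, $v\in L$. With $M^*=\operatorname{Hom}_R(M,R)$, $T^1(R)$ is the cokernel of the restriction map $(\bigoplus_iR\,dx_i)^*\to U^*$; it is $\mathbb{Z}H$-graded and isomorphic to $\operatorname{Ext}^1_R(\Omega_{R/K},R)$. $K[G]$ is inseparable if $L$ is inseparable in the following sense. For a lattice $L$, $I_L=(f_v:v\in L)$; $L$ is saturated if $\mathbb{Z}^n/L$ is torsionfree. Let $\pi_i:S[x_{n+1}]\to S$ be the $K$-algebra map with $\pi_i(x_j)=x_j$ ($j\le n$), $\pi_i(x_{n+1})=x_i$. A saturated $L\subset\mathbb{Z}^n$ is $i$-separable if there is a saturated $L'\subset\mathbb{Z}^{n+1}$ such that (i) $\operatorname{rank}L'=\operatorname{rank}L$; (ii) $\pi_i(I_{L'})=I_L$; (iii) there is a minimal system of generators $f_{w_1},\ldots,f_{w_s}$ of $I_{L'}$ such that $(w_1(n+1),\ldots,w_s(n+1))$ and $(w_1(i),\ldots,w_s(i))$ are linearly independent. $L$ is inseparable if it is not $i$-separable for any $i$. *)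

(* Defs.v *)
From HB Require Import structures.
From mathcomp Require Import all_boot all_order all_algebra.
From mathcomp Require Import boolp classical_sets.
From mathcomp Require Import mpoly.

Set Implicit Arguments.
Unset Strict Implicit.
Unset Printing Implicit Defensive.

Import Order.TTheory GRing.Theory Num.Theory.

Local Open Scope classical_set_scope.
Local Open Scope ring_scope.

Section Submodules.
Context (A : pzRingType) (V : lmodType A).

Definition is_submodule (M : set V) : Prop :=
  M 0 /\ forall (c : A) (u v : V), M u -> M v -> M (c *: u + v).

Definition submodule_gen (X : set V) : set V := smallest is_submodule X.

Lemma submodule_gen_closed (X : set V) : is_submodule (submodule_gen X).
Proof.
split=> [M [[]] //|c u v Xu Xv M [[M0 MD] XM]].
by apply: (MD); [apply: Xu | apply: Xv].
Qed.

Definition submodule_pred (X : set V) : {pred V} :=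
  fun u => `[< submodule_gen X u >].

Lemma submodule_pred_closed (X : set V) : submod_closed (submodule_pred X).
Proof.
have [X0 XD] := submodule_gen_closed X.
split=> [|c u v /asboolP Xu /asboolP Xv]; apply/asboolP => //.
exact: XD.
Qed.

HB.instance Definition _ (X : set V) :=
  GRing.isSubmodClosed.Build A V (submodule_pred X) (submodule_pred_closed X).

Record submodule_type (X : set V) := SubmoduleElt {
  submodule_val : V;
  _ : submodule_val \in submodule_pred X
}.

HB.instance Definition _ (X : set V) := [isSub for @submodule_val X].
HB.instance Definition _ (X : set V) := [Choice of submodule_type X by <:].
HB.instance Definition _ (X : set V) :=
  [SubChoice_isSubLmodule of submodule_type X by <:].
End Submodules.

Definition ideal_gen (A : comPzRingType) (X : set A) : set A :=
  @submodule_gen A A^o X.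

Section Lattices.
Context (n : nat).

Definition is_lattice (L : set 'rV[int]_n) : Prop :=
  L 0 /\ forall u v, L u -> L v -> L (u - v).

(* Z^n / L is torsionfree *)
Definition saturated (L : set 'rV[int]_n) : Prop :=
  forall (k : int) (v : 'rV[int]_n), k != 0 -> L (k *: v) -> L v.

Definition int_row_free (r s : nat) (B : 'M[int]_(r, s)) : bool :=
  row_free (map_mx intr B : 'M[rat]_(r, s)).

(* L has rank r: it has a Z-basis of r vectors (every lattice in Z^n has a
   basis, and all of its bases have the same size). *)
Definition has_rank (L : set 'rV[int]_n) (r : nat) : Prop :=
  exists2 B : 'M[int]_(r, n),
    int_row_free B & L = [set c *m B | c in [set: 'rV[int]_r]].

Definition lattice_binomial (K : fieldType) (v : 'rV[int]_n) : {mpoly K[n]} :=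
  \prod_(i | 0 <= v 0 i) 'X_i ^+ absz (v 0 i)
    - \prod_(i | v 0 i <= 0) 'X_i ^+ absz (v 0 i).

Definition lattice_ideal (K : fieldType) (L : set 'rV[int]_n) :
    set {mpoly K[n]} :=
  ideal_gen [set lattice_binomial K v | v in L].
Arguments lattice_ideal : clear implicits.

(* The binomials attached to the rows of W form a minimal system of generators
   of the lattice ideal of L. *)
Definition min_gens (K : fieldType) (L : set 'rV[int]_n) (s : nat)
    (W : 'M[int]_(s, n)) : Prop :=
  [/\ forall j, L (row j W),
      ideal_gen [set lattice_binomial K (row j W) | j in [set: 'I_s]]
        = lattice_ideal K L
    & forall k, ideal_gen [set lattice_binomial K (row j W) | j in [set~ k]]
        <> lattice_ideal K L].
End Lattices.
Arguments lattice_ideal {n} K L.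

(* The K-algebra map x_{n+1} |-> x_i, x_j |-> x_j for j <= n; the last variable
   x_{n+1} has index ord_max, and x_j has index lift ord_max j. *)
Definition identify_last (K : fieldType) (n : nat) (i : 'I_n)
    (p : {mpoly K[n.+1]}) : {mpoly K[n]} :=
  p \mPo [tuple (if unlift ord_max j is Some k then 'X_k else 'X_i) | j < n.+1].

Definition separable_at (K : fieldType) (n : nat) (L : set 'rV[int]_n)
    (i : 'I_n) : Prop :=
  exists L' : set 'rV[int]_n.+1,
    [/\ is_lattice L', saturated L',
        exists2 r, has_rank L r & has_rank L' r,
        [set identify_last i p | p in lattice_ideal K L'] = lattice_ideal K L
      & exists s (W : 'M[int]_(s, n.+1)),
          min_gens K L' W /\
          int_row_free
            (col_mx (col ord_max W)^T (col (lift ord_max i) W)^T)].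

(* A simple graph on 'I_m together with a labelling of its edges by 'I_n. *)
Record graph (m n : nat) := Graph {
  edge :> 'I_n -> {set 'I_m};
  card_edge : forall k, #|edge k| = 2%N;
  edge_inj : injective edge
}.

Section Graphs.
Context (m n : nat) (G : graph m n).

Definition adj : rel 'I_m := fun i j => [exists k, G k == [set i; j]%SET].

Definition bipartite : Prop :=
  exists A : {set 'I_m}, forall i j, adj i j -> (i \in A) != (j \in A).

(* A cycle is given by its vertices, listed consecutively; cycles having the
   same edges are the same subgraph. *)
Definition is_cycle (c : seq 'I_m) : bool := (2 < size c)%N && ucycleb adj c.

Definition cycle_edges (c : seq 'I_m) : seq {set 'I_m} :=
  [seq [set x; next c x]%SET | x <- c].

Definition induced_cycle (c : seq 'I_m) : Prop :=
  is_cycle c /\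
  forall x y, x \in c -> y \in c -> adj x y ->
    [set x; y]%SET \in cycle_edges c.

Definition same_parity (c : seq 'I_m) (e f : {set 'I_m}) : Prop :=
  [/\ e != f, e \in cycle_edges c, f \in cycle_edges c
    & odd (index e (cycle_edges c)) = odd (index f (cycle_edges c))].

Definition h (k : 'I_n) : 'rV[int]_m := \sum_(i in G k) delta_mx 0 i.

Definition H : set 'rV[int]_m :=
  [set a | exists c : 'I_n -> nat, a = \sum_k h k *+ c k].

Definition ZH : set 'rV[int]_m :=
  [set a | exists c : 'I_n -> int, a = \sum_k h k *~ c k].

Definition relation_lattice : set 'rV[int]_n :=
  [set v | \sum_k h k *~ v 0 k = 0].

Lemma relation_lattice_is_lattice : is_lattice relation_lattice.
Proof.
split=> [|u v Lu Lv].
  by rewrite /relation_lattice /= big1 // => k _; rewrite mxE mulr0z.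
have -> : relation_lattice (u - v) =
    (\sum_k h k *~ u 0 k - \sum_k h k *~ v 0 k = 0).
  rewrite /relation_lattice /= -sumrB; congr (_ = _).
  by apply: eq_bigr => k _; rewrite !mxE mulrzBr.
by rewrite Lu Lv subr0.
Qed.

Lemma relation_lattice_saturated : saturated relation_lattice.
Proof.
move=> c v c0; rewrite /relation_lattice /= => Lv.
have {Lv} : (\sum_k h k *~ v 0 k) *~ c = 0.
  rewrite -[RHS]Lv -(@scaler_int int _ c) scaler_sumr; apply: eq_bigr => k _.
  by rewrite scaler_int !mxE mulrzA_C.
move=> /matrixP Lv; apply/matrixP => i j; move: (Lv i j).
rewrite -scaler_int !mxE intz => /eqP; rewrite mulf_eq0 (negPf c0) /=.
by move/eqP.
Qed.

Definition inseparable (K : fieldType) : Prop :=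
  forall i : 'I_n, ~ separable_at K relation_lattice i.

Definition relation_degree (v : 'rV[int]_n) : 'rV[int]_m :=
  \sum_(i | 0 <= v 0 i) h i *~ v 0 i.

Context (K : fieldType).

Definition mon_degree (u : 'X_{1..m}) : 'rV[int]_m := \row_i (u i)%:Z.

(* K[H], as a subring of K[t_1, ..., t_m] *)
Definition edge_ring_pred : {pred {mpoly K[m]}} :=
  fun p => all (fun u => `[< H (mon_degree u) >]) (msupp p).

Lemma edge_ring_predP (p : {mpoly K[m]}) :
  reflect (forall u, u \in msupp p -> H (mon_degree u)) (p \in edge_ring_pred).
Proof.
by apply: (iffP allP) => Hp u /Hp /asboolP.
Qed.

Lemma H0 : H 0.
Proof. by exists (fun=> 0%N); rewrite big1. Qed.

Lemma HD a b : H a -> H b -> H (a + b).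
Proof.
move=> [c ->] [d ->]; exists (fun k => c k + d k)%N.
by rewrite -big_split; apply: eq_bigr => k _; rewrite mulrnDr.
Qed.

Lemma mon_degreeD u v : mon_degree (u + v)%MM = mon_degree u + mon_degree v.
Proof. by apply/rowP => i; rewrite !mxE mnmDE PoszD. Qed.

Lemma edge_ring_closed : subring_closed edge_ring_pred.
Proof.
split=> [|p q /edge_ring_predP Hp /edge_ring_predP Hq
         |p q /edge_ring_predP Hp /edge_ring_predP Hq]; apply/edge_ring_predP => u.
- rewrite msupp1 inE => /eqP ->; suff -> : mon_degree 0%MM = 0 by exact: H0.
  by apply/rowP => i; rewrite !mxE mnm0E.
- by move/msuppB_le; rewrite mem_cat => /orP[/Hp|/Hq].
- move/msuppM_le/allpairsP => [[a b] /= [/Hp Ha /Hq Hb ->]].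
  by rewrite mon_degreeD; exact: HD.
Qed.

HB.instance Definition _ :=
  GRing.isSubringClosed.Build {mpoly K[m]} edge_ring_pred edge_ring_closed.

Record edge_ring := EdgeRing {
  edge_ring_val : {mpoly K[m]};
  _ : edge_ring_val \in edge_ring_pred
}.

HB.instance Definition _ := [isSub for edge_ring_val].
HB.instance Definition _ := [Choice of edge_ring by <:].
HB.instance Definition _ := [SubChoice_isSubComNzRing of edge_ring by <:].

(* t^a for a with nonnegative entries *)
Definition tpow (a : 'rV[int]_m) : {mpoly K[m]} :=
  'X_[ [multinom absz (a ord0 i) | i < m] ].

(* The vector (v(i) t^{h(v)-h_i})_i in the free module with basis dx_1..dx_n.
   By [val_df], the default value of insubd is never used. *)
Definition df (v : 'rV[int]_n) : 'rV[edge_ring]_n :=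
  \row_i insubd (0 : edge_ring) ((v 0 i)%:~R *: tpow (relation_degree v - h i)).

Lemma H_ge0 a : H a -> forall i, 0 <= a 0 i.
Proof.
move=> [c ->] i; rewrite summxE; apply: sumr_ge0 => k _.
rewrite -(@scaler_nat int) mxE mulr_ge0 ?ler0n // summxE; apply: sumr_ge0 => j _.
by rewrite mxE ler0n.
Qed.

Lemma relation_degreeBh v i :
  relation_lattice v -> v 0 i != 0 -> H (relation_degree v - h i).
Proof.
move=> Lv vi0.
have sub (P : pred 'I_n) (c : 'I_n -> nat) : P i -> (0 < c i)%N ->
    H (\sum_(k | P k) h k *+ c k - h i).
  move=> Pi ci; exists (fun k => if P k then (c k - (k == i))%N else 0%N).
  rewrite (bigD1 i) //= [RHS](bigD1 i) //= Pi eqxx subn1.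
  rewrite -{1}(prednK ci) mulrS -!addrA [LHS]addrC -!addrA addNr addr0.
  congr (_ + _).
  rewrite big_mkcondl; apply: eq_bigr => k /negPf ->.
  by rewrite subn0; case: (P k); rewrite ?mulr0n.
have [vi|vi|/eqP] := ltrgtP 0 (v 0 i); last by rewrite eq_sym (negPf vi0).
  have -> : relation_degree v = \sum_(k | 0 <= v 0 k) h k *+ absz (v 0 k).
    by apply: eq_bigr => k vk; rewrite pmulrn gez0_abs.
  by apply: sub; rewrite ?ltW // absz_gt0.
have -> : relation_degree v = \sum_(k | ~~ (0 <= v 0 k)) h k *+ absz (v 0 k).
  move: Lv; rewrite /relation_lattice /= (bigID (fun k => 0 <= v 0 k)) /=.
  move/eqP; rewrite addr_eq0 => /eqP E; rewrite /relation_degree E -sumrN.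
  apply: eq_bigr => k; rewrite -ltNge => vk.
  by rewrite pmulrn ltz0_abs // mulrNz.
by apply: sub; rewrite ?absz_gt0 // -ltNge.
Qed.

Lemma val_df v i : relation_lattice v ->
  val (df v 0 i) = (v 0 i)%:~R *: tpow (relation_degree v - h i).
Proof.
move=> Lv; rewrite mxE insubdK //; apply/edge_ring_predP => u.
have [->|vi0] := eqVneq (v 0 i) 0; first by rewrite mulr0z scale0r msupp0.
move/msuppZ_le; rewrite msuppX inE => /eqP ->.
have Hv := relation_degreeBh Lv vi0.
suff -> : mon_degree [multinom absz ((relation_degree v - h i)%R ord0 j) | j < m]
    = relation_degree v - h i by [].
by apply/rowP => j; rewrite mxE mnmE gez0_abs ?H_ge0.
Qed.

Definition df_gens : set 'rV[edge_ring]_n := [set df v | v in relation_lattice].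

Definition df_module := submodule_type df_gens.
HB.instance Definition _ := GRing.Lmodule.on df_module.

Definition mon_homog (b : 'rV[int]_m) (r : edge_ring) : Prop :=
  forall u, u \in msupp (val r) -> mon_degree u = b.

(* homogeneous of degree b, where deg dx_i = h_i *)
Definition free_homog (b : 'rV[int]_m) (w : 'rV[edge_ring]_n) : Prop :=
  forall i, mon_homog (b - h i) (w 0 i).

Definition free_dual_homog (a : 'rV[int]_m)
    (psi : {linear 'rV[edge_ring]_n -> edge_ring^o}) : Prop :=
  forall b w, free_homog b w -> mon_homog (a + b) (psi w).

Definition df_module_dual_homog (a : 'rV[int]_m)
    (phi : {linear df_module -> edge_ring^o}) : Prop :=
  forall b u, free_homog b (val u) -> mon_homog (a + b) (phi u).

(* T^1(R)_a = 0: the degree-a component of the restriction map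
   (+_i R dx_i)^* -> df_module^* is onto. *)
Definition T1_component_zero (a : 'rV[int]_m) : Prop :=
  forall phi : {linear df_module -> edge_ring^o}, df_module_dual_homog a phi ->
  exists psi : {linear 'rV[edge_ring]_n -> edge_ring^o},
    free_dual_homog a psi /\ forall u : df_module, phi u = psi (val u).

Definition semi_rigid : Prop :=
  forall a, ZH a -> H (- a) -> T1_component_zero a.
End Graphs.

(* Main.v *)
(* Let L be the relation lattice. A functional phi of degree -b on U amounts to
   the additive map c : L -> K sending v to the value of phi(df_v) at
   t = (1, .., 1), which vanishes on every v such that h(v) - b is not in H.
   Inseparability forces such a map to be a multiple of v(e) when b = h_e:
   otherwise, for e = {x, y}, the v in L with v(e) = 0 include a nonzero flow
   from x to y through some union Q of components of G - x - y, and rerouting the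
   flow through Q along a copy x_{n+1} of x_e separates L at e. Hence, if
   b = h_e + h_f + b' with b' in H and c is nonzero, then c is a multiple both of
   v(e) and of v(f); a cycle then contains e if and only if it contains f, and the
   condition h(v) - h_e - h_f in H on the vector v of an induced cycle yields the
   equality of parities. Conversely, if no induced cycle separates e from f, then
   v(e) and v(f) are proportional on L, and equal by the parity condition, so that
   u |-> u_e / t^(h_f) is a functional of degree -(h_e + h_f); it does not extend
   to the free module, whose dual vanishes in that degree. *)

Require Import Defs.
From HB Require Import structures.
From mathcomp Require Import all_boot all_order all_algebra.
From mathcomp Require Import boolp classical_sets.
From mathcomp Require Import mpoly zify ring.

Set Implicit Arguments.
Unset Strict Implicit.
Unset Printing Implicit Defensive.

Import Order.TTheory GRing.Theory Num.Theory.
Local Open Scope ring_scope.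

(** * Incidence matrix and cycles *)

Section Incidence.
Context (m n : nat) (G : graph m n).
Implicit Types (v w : 'rV[int]_n).

(** Multiplying vertex coordinates by the signs of the bipartition turns each h_k into the boundary
    of an arc, so L becomes the lattice of circulations of G; the flows and the decomposition into
    cycles rest on this. Inseparability enters in this form: if v(e) = 0, then v carries no flow
    from x to y through any component of G - x - y. The part of v at y can then be closed up inside
    these components without touching x, so that v = u + (v - u) with u zero on the edges at x and v
    - u zero on those at y. Neither h(u) - h_e nor h(v - u) - h_e is in H, as one coordinate is -1,
    and therefore c(v) = 0. The obstacle in separating L is that condition (iii) speaks of minimal
    generators. Cycles provide a finite generating set with entries -1, 0, 1, from which a minimal
    one is extracted without knowing it explicitly. Independence of its two columns is tested on all
    of L' instead: a linear relation that holds on the generators holds on L', by evaluation at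
    powers of 2, which has infinite multiplicative order in characteristic 0. *)

Definition incidence : 'M[int]_(n, m) := \matrix_(k, i) (i \in G k)%:R.

Lemma hE k i : h G k 0 i = (i \in G k)%:R.
Proof.
rewrite summxE; have [iGk|iNGk] := boolP (i \in G k); last first.
  by rewrite big1 // => j jGk; rewrite mxE eqxx; case: eqP iNGk => // ->; rewrite jGk.
rewrite (bigD1 i) //= mxE !eqxx big1 ?addr0 // => j /andP[_ ji].
by rewrite mxE eq_sym (negPf ji) andbF.
Qed.

Lemma mul_incidence (v : 'rV[int]_n) : v *m incidence = \sum_k h G k *~ v 0 k.
Proof.
apply/rowP => i; rewrite mxE summxE; apply: eq_bigr => k _.
by rewrite -scaler_int !mxE -hE intz.
Qed.

Lemma relation_latticeP (v : 'rV[int]_n) :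
  relation_lattice G v <-> v *m incidence = 0.
Proof. by rewrite mul_incidence. Qed.

Lemma relation_lattice0 : relation_lattice G 0.
Proof. by have [] := relation_lattice_is_lattice G. Qed.

Lemma relation_latticeB v w :
  relation_lattice G v -> relation_lattice G w -> relation_lattice G (v - w).
Proof. exact: (relation_lattice_is_lattice G).2. Qed.

Lemma relation_latticeD v w :
  relation_lattice G v -> relation_lattice G w -> relation_lattice G (v + w).
Proof.
move=> Lv Lw; rewrite -[w]opprK -[- w]sub0r.
by do 2?[apply: relation_latticeB => //]; apply: relation_lattice0.
Qed.

Lemma relation_latticeZ (k : int) v :
  relation_lattice G v -> relation_lattice G (k *: v).
Proof.
move=> /relation_latticeP Lv; apply/relation_latticeP.
by rewrite -scalemxAl Lv scaler0.
Qed.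

Lemma relation_lattice_additiveZ (K : pzRingType) (c : 'rV[int]_n -> K) :
    (forall v w, relation_lattice G v -> relation_lattice G w ->
      c (v + w) = c v + c w) ->
  forall (k : int) v, relation_lattice G v -> c (k *: v) = k%:~R * c v.
Proof.
move=> cD k v Lv.
have c0 : c 0 = 0.
  by apply: (addrI (c 0)); rewrite -cD ?addr0 //; apply: relation_lattice0.
have cn (j : nat) : c (j%:Z *: v) = j%:R * c v.
  elim: j => [|j IHj]; first by rewrite scale0r mul0r.
  rewrite intS scalerDl scale1r cD ?IHj ?mulrS ?mulrDl ?mul1r //.
  exact: relation_latticeZ.
case: k => j; first exact: cn.
rewrite NegzE; apply: (addrI (c (j.+1%:Z *: v))).
rewrite -cD; [|exact: relation_latticeZ..].
by rewrite -scalerDl addrN scale0r c0 cn mulrNz mulNr addrN.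
Qed.

Lemma adjP i j : reflect (exists k, G k = [set i; j]%SET) (adj G i j).
Proof. by apply: (iffP existsP) => -[k /eqP]; exists k => //; apply/eqP. Qed.

Lemma adj_sym i j : adj G i j = adj G j i.
Proof. by rewrite /adj; apply: eq_existsb => k; rewrite finset.setUC. Qed.

Lemma adj_neq i j : adj G i j -> i != j.
Proof.
case/adjP => k Gk; have := card_edge G k; rewrite Gk cards2.
by case: (i != j).
Qed.

Lemma edge_endpoint k i : i \in G k -> exists2 j, adj G i j & G k = [set i; j]%SET.
Proof.
move=> iGk; have /eqP/cards2P[a [b] [ab Gk]] := card_edge G k.
move: iGk; rewrite Gk !inE => /orP[]/eqP ->.
  by exists b => //; apply/adjP; exists k.
by exists a; rewrite 1?finset.setUC //; apply/adjP; exists k; rewrite finset.setUC.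
Qed.

(** Indexed by end points, so that sums along a list of vertices need no edge labels; it is 0 when
    [i] and [j] are not adjacent. *)
Definition edge_vec (i j : 'I_m) : 'rV[int]_n :=
  \row_k (G k == [set i; j]%SET)%:R.

Lemma edge_vec_delta k i j :
  G k = [set i; j]%SET -> edge_vec i j = delta_mx 0 k.
Proof.
move=> Gk; apply/rowP => l; rewrite !mxE -Gk.
by rewrite (inj_eq (@edge_inj _ _ G)).
Qed.

Lemma delta_incidence k : delta_mx 0 k *m incidence = h G k.
Proof.
by rewrite -rowE; apply/rowP => i; rewrite hE !mxE.
Qed.

Lemma h_set2 k i j :
  G k = [set i; j]%SET -> h G k = delta_mx 0 i + delta_mx 0 j.
Proof.
move=> Gk; have ij : i != j by apply: adj_neq; apply/adjP; exists k.
apply/rowP => z; rewrite hE Gk !mxE !inE /=.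
have [->|zi] := eqVneq z i; first by rewrite (negPf ij) addr0.
by rewrite add0r.
Qed.

Lemma edge_vec_incidence i j :
  adj G i j -> edge_vec i j *m incidence = delta_mx 0 i + delta_mx 0 j.
Proof.
by case/adjP=> k Gk; rewrite (edge_vec_delta Gk) delta_incidence (h_set2 Gk).
Qed.

End Incidence.

Section CycleEdges.
Context (T : eqType).
Implicit Types (x : T) (c : seq T).

Lemma next_neq2 c x : uniq c -> (2 < size c)%N -> x \in c -> next c (next c x) != x.
Proof.
move=> Uc sc xc; have [i c' def_c] := rot_to xc.
rewrite -!(next_rot i Uc) def_c.
have : uniq (rot i c) by rewrite rot_uniq.
have : (2 < size (rot i c))%N by rewrite size_rot.
rewrite def_c; case: c' {def_c} => [|y [|z c']] //= _.
rewrite !inE !negb_or !eqxx => /and4P[/and3P[xy xz _] /andP[yz _] _ _].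
by rewrite [y == x]eq_sym (negPf xy) eq_sym.
Qed.

End CycleEdges.

Section Cycles.
Context (m n : nat) (G : graph m n).
Implicit Types c : seq 'I_m.

Lemma is_cycleP c :
  reflect [/\ (2 < size c)%N, cycle (adj G) c & uniq c] (is_cycle G c).
Proof. by apply: (iffP and3P). Qed.

(** Equality for x != y would give y = next x and x = next y, a cycle of length two. *)
Lemma cycle_edge_inj c : is_cycle G c -> {in c &, injective (fun x => [set x; next c x]%SET)}.
Proof.
case/is_cycleP=> sc _ Uc x y xc yc /setP E.
have [//|xy] := eqVneq x y.
have := E x; rewrite !inE eqxx (negPf xy) /= => /esym/eqP xE.
have := E y; rewrite !inE eqxx eq_sym (negPf xy) /= => /eqP yE.
by have := next_neq2 Uc sc xc; rewrite -yE -xE eqxx.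
Qed.

Lemma uniq_cycle_edges c : is_cycle G c -> uniq (cycle_edges c).
Proof.
move=> Cc; rewrite map_inj_in_uniq; last exact: cycle_edge_inj Cc.
by case/is_cycleP: Cc.
Qed.

Lemma cycle_edges_adj c x : is_cycle G c -> x \in c -> adj G x (next c x).
Proof. by case/is_cycleP=> _ cc _; apply: next_cycle. Qed.

End Cycles.

(** * Cutting a cycle along a chord *)

Section Chords.
Context (m n : nat) (G : graph m n).
Implicit Types (x : 'I_m) (p c : seq 'I_m).

Lemma cycle_edges_rot i c :
  uniq c -> cycle_edges (rot i c) = rot i (cycle_edges c).
Proof.
by move=> Uc; rewrite /cycle_edges -map_rot; apply: eq_map => x; rewrite next_rot.
Qed.

(** In [pairmap] form the edge list splits along a concatenation of vertex lists. *)
Lemma cycle_edges_cons x p : uniq (x :: p) ->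
  cycle_edges (x :: p) = pairmap (fun u v => [set u; v]%SET) x (rcons p x).
Proof.
move=> U; apply: (@eq_from_nth _ finset.set0) => [|i].
  by rewrite size_map size_pairmap size_rcons.
rewrite size_map => ip; rewrite (nth_map x) // next_nth mem_nth //.
rewrite index_uniq // (nth_pairmap x) ?size_rcons // nth_rcons_default.
by rewrite -rcons_cons nth_rcons ip.
Qed.

(** The chord closes each of the two arcs between [a] and [b] to a cycle. It lies on both, so it
    cancels modulo 2. *)
Lemma chord_split c a b :
    is_cycle G c -> a \in c -> b \in c -> adj G a b ->
    [set a; b]%SET \notin cycle_edges c ->
  exists c1 c2, [/\ is_cycle G c1, is_cycle G c2, (size c1 < size c)%N,
    (size c2 < size c)%N
    & forall E, (E \in cycle_edges c)
              = (E \in cycle_edges c1) (+) (E \in cycle_edges c2)].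
Proof.
move=> Cc ac bc ab abNc; have /is_cycleP[sc cc Uc] := Cc.
have Ue := uniq_cycle_edges Cc.
have [i p def_c] := rot_to ac.
have Up : uniq (a :: p) by rewrite -def_c rot_uniq.
have Ee := cycle_edges_rot i Uc; rewrite def_c in Ee.
have [p1 [p2 def_p]] : exists p1 p2, p = p1 ++ b :: p2.
  have : b \in p.
    have : b \in a :: p by rewrite -def_c mem_rot.
    by rewrite inE eq_sym (negPf (adj_neq ab)).
  by case/splitPr=> p1 p2; exists p1, p2.
pose E := pairmap (fun u v : 'I_m => [set u; v]%SET).
have def_e : cycle_edges (a :: p) = E a (rcons p1 b) ++ E b (rcons p2 a).
  by rewrite cycle_edges_cons // def_p rcons_cat rcons_cons -cat_rcons
             /E pairmap_cat last_rcons.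
have abN : [set a; b]%SET \notin E a (rcons p1 b) ++ E b (rcons p2 a).
  by rewrite -def_e Ee mem_rot.
have ba : [set b; a]%SET = [set a; b]%SET by rewrite finset.setUC.
have p1_gt0 : (0 < size p1)%N.
  by case: (p1) abN => //=; rewrite inE eqxx.
have p2_gt0 : (0 < size p2)%N.
  by case: (p2) abN => //=; rewrite mem_cat !inE ba eqxx orbT.
have /andP[cc1 cc2] : path (adj G) a (rcons p1 b) && path (adj G) b (rcons p2 a).
  have : cycle (adj G) (a :: p) by rewrite -def_c rot_cycle.
  by rewrite /= def_p rcons_cat rcons_cons -cat_rcons cat_path last_rcons.
have [sz szp] : (size c = (size p1 + size p2).+2) /\ size p = (size p1 + size p2).+1.
  by rewrite -(size_rot i c) def_c def_p /= size_cat /= addnS.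
have U1 : uniq (a :: rcons p1 b).
  by move: Up; rewrite def_p -cat_rcons -cat_cons cat_uniq => /andP[].
have U2 : uniq (b :: rcons p2 a).
  rewrite -rcons_cons rcons_uniq; move: Up; rewrite def_p /= cat_uniq mem_cat.
  by rewrite negb_or -andbA => /and5P[_ -> _ _].
have Ue' : uniq (E a (rcons p1 b) ++ E b (rcons p2 a)).
  by rewrite -def_e Ee rot_uniq.
exists (a :: rcons p1 b), (b :: rcons p2 a); split.
- apply/is_cycleP; split=> //; first by rewrite /= size_rcons.
  by rewrite /= rcons_path cc1 last_rcons adj_sym ab.
- apply/is_cycleP; split=> //; first by rewrite /= size_rcons.
  by rewrite /= rcons_path cc2 last_rcons ab.
- by rewrite /= size_rcons sz !ltnS -[ltnLHS]addn0 ltn_add2l.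
- by rewrite /= size_rcons sz !ltnS -[ltnLHS]add0n ltn_add2r.
move=> F; rewrite !cycle_edges_cons // -/E.
have e1 : E a (rcons (rcons p1 b) a) = E a (rcons p1 b) ++ [:: [set a; b]%SET].
  by rewrite -[rcons (rcons p1 b) a]cats1 /E pairmap_cat last_rcons /= ba.
have e2 : E b (rcons (rcons p2 a) b) = E b (rcons p2 a) ++ [:: [set a; b]%SET].
  by rewrite -[rcons (rcons p2 a) b]cats1 /E pairmap_cat last_rcons /=.
rewrite -(mem_rot i) -Ee def_e e1 e2 !mem_cat !inE.
have [->|_] := eqVneq F [set a; b]%SET; rewrite ?orbF.
  by rewrite !orbT addbb; apply/negbTE; rewrite -mem_cat.
move: Ue'; rewrite cat_uniq => /and3P[_ /hasPn dis _].
have := dis F; case: (F \in E b _) => [/(_ isT)/=/negPf->//|_].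
by rewrite orbF addbF.
Qed.

(** Additivity modulo 2 passes [P] on to one of the two shorter cycles cut off by a chord. *)
Lemma exists_induced_cycle (P : seq 'I_m -> bool) :
    (forall c c1 c2,
       (forall E, (E \in cycle_edges c)
                = (E \in cycle_edges c1) (+) (E \in cycle_edges c2)) ->
       P c = P c1 (+) P c2) ->
  forall c, is_cycle G c -> P c -> exists2 c', induced_cycle G c' & P c'.
Proof.
move=> Padd c; have [s] := ubnP (size c); elim: s c => // s IHs c.
rewrite ltnS => le_s Cc Pc.
have [Ic|] := pselect (induced_cycle G c); first by exists c.
move=> NIc; have [[a b] /= [ac bc ab abN]] :
    exists ab : 'I_m * 'I_m, [/\ ab.1 \in c, ab.2 \in c, adj G ab.1 ab.2
      & [set ab.1; ab.2]%SET \notin cycle_edges c].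
  apply: contrapT => H; apply: NIc; split=> // x y xc yc xy.
  by apply: contrapT => /negP N; apply: H; exists (x, y).
have [c1 [c2 [C1 C2 lt1 lt2 E12]]] := chord_split Cc ac bc ab abN.
move: Pc; rewrite (Padd _ _ _ E12) => P12.
have [P1|NP1] := boolP (P c1); first exact: IHs (leq_trans lt1 le_s) C1 P1.
by apply: IHs (leq_trans lt2 le_s) C2 _; move: P12; rewrite (negPf NP1).
Qed.

End Chords.

(** * Conformal decomposition into cycles *)

Definition conformal n (w v : 'rV[int]_n) : Prop :=
  forall k, (0 <= w 0 k <= v 0 k) || (v 0 k <= w 0 k <= 0).

Lemma conformal_eq0 n (w v : 'rV[int]_n) k :
  conformal w v -> v 0 k = 0 -> w 0 k = 0.
Proof. by move=> /(_ k) + v0; rewrite v0; lia. Qed.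

(** Each entry of a conformal [w] has the sign of that of [v] and is no larger, so subtracting [w]
    lowers the sum of the absolute values. *)
Lemma conformal_ind n (L B : set 'rV[int]_n) (P : 'rV[int]_n -> Prop) :
    is_lattice L ->
    (forall v, L v -> v != 0 -> exists w, [/\ B w, L w, w != 0 & conformal w v]) ->
    P 0 ->
    (forall w v, B w -> L w -> L v -> conformal w (w + v) -> P v -> P (w + v)) ->
  forall v, L v -> P v.
Proof.
move=> [L0 LB] exB P0 PD v.
have [s] := ubnP (\sum_k absz (v 0%R k)).
elim: s v => // s IHs v; rewrite ltnS => le_s Lv.
have [->//|v0] := eqVneq v 0.
have [w [Bw Lw w0 wv]] := exB v Lv v0.
have def_v : v = w + (v - w) by rewrite addrC subrK.
rewrite def_v; apply: PD => //; [exact: LB | by rewrite -def_v |].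
apply: IHs (LB _ _ Lv Lw); apply: leq_trans le_s.
have [k wk0] : exists k, w 0 k != 0.
  apply: contrapT => H; case/eqP: w0; apply/rowP => k; rewrite mxE.
  by apply: contrapT => /eqP wk; apply: H; exists k.
rewrite [ltnLHS](bigD1 k) // [ltnRHS](bigD1 k) //= -addSn leq_add //.
  by have := wv k; rewrite !mxE; move: (w 0 k) (v 0 k) wk0; clear; lia.
by apply: leq_sum => i _; have := wv i; rewrite !mxE; move: (w 0 i) (v 0 i); clear; lia.
Qed.

Section Bipartite.
Context (m n : nat) (G : graph m n) (A : {set 'I_m}).
Hypothesis bipA : forall i j, adj G i j -> (i \in A) != (j \in A).
Implicit Types (c : seq 'I_m) (v w : 'rV[int]_n).

(** With these signs on the vertices, h_k becomes a difference of two basis vectors and relations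
    become circulations. *)
Definition side (i : 'I_m) : int := if i \in A then 1 else -1.

Lemma side_adj i j : adj G i j -> side j = - side i.
Proof. by move/bipA; rewrite /side; do 2!case: (_ \in A); rewrite ?opprK. Qed.

Lemma side_neq0 i : side i != 0.
Proof. by rewrite /side; case: ifP. Qed.

Lemma side_sqr i : side i * side i = 1.
Proof. by rewrite /side; case: ifP. Qed.

Definition cycle_vec c : 'rV[int]_n :=
  \sum_(x <- c) side x *: edge_vec G x (next c x).

Lemma perm_next c : uniq c -> perm_eq (map (next c) c) c.
Proof.
move=> Uc; have nextK := can_inj (prev_next Uc).
apply: uniq_perm; rewrite ?map_inj_uniq // => y; apply/mapP/idP => [[x xc ->]|yc].
  by rewrite mem_next.
by exists (prev c y); rewrite ?mem_prev ?next_prev.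
Qed.

(** The sign changes from x to its successor, so each edge contributes a difference of signed basis
    vectors, and the sum around the cycle telescopes. *)
Lemma cycle_vec_lattice c : is_cycle G c -> relation_lattice G (cycle_vec c).
Proof.
move=> Cc; have /is_cycleP[_ _ Uc] := Cc.
apply/relation_latticeP; rewrite mulmx_suml.
transitivity (\sum_(x <- c) side x *: delta_mx 0 x
   - \sum_(x <- c) side (next c x) *: delta_mx 0 (next c x) : 'rV[int]_m).
  rewrite -sumrB; apply: eq_big_seq => x xc.
  have xnx := cycle_edges_adj Cc xc.
  by rewrite -scalemxAl edge_vec_incidence // scalerDr (side_adj xnx) scaleNr opprK.
apply/eqP; rewrite subr_eq0; apply/eqP.
rewrite -(big_map (next c) xpredT (fun x => side x *: delta_mx 0 x)).
by apply/esym/perm_big/perm_next.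
Qed.

Lemma cycle_vecE c k x : is_cycle G c -> x \in c ->
  G k = [set x; next c x]%SET -> cycle_vec c 0 k = side x.
Proof.
move=> Cc xc Gk; have /is_cycleP[_ _ Uc] := Cc.
rewrite summxE (bigD1_seq x) //= !mxE -Gk eqxx mulr1 big_seq_cond big1 ?addr0 // => y.
case/andP=> yc yx; rewrite !mxE Gk.
case: eqP => [E|]; last by rewrite mulr0.
by rewrite (cycle_edge_inj Cc xc yc E) eqxx in yx.
Qed.

Lemma cycle_vec_eq0 c k : is_cycle G c ->
  (cycle_vec c 0 k == 0) = (G k \notin cycle_edges c).
Proof.
move=> Cc; have [/mapP[x xc Gk]|GkN] := boolP (G k \in cycle_edges c).
  by rewrite (cycle_vecE Cc xc Gk) (negPf (side_neq0 x)).
rewrite summxE big_seq big1 ?eqxx // => x xc; rewrite !mxE.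
case: eqP => [Gk|]; last by rewrite mulr0.
by case/mapP: GkN; exists x.
Qed.

Lemma cycle_vec_neq0 c : is_cycle G c -> cycle_vec c != 0.
Proof.
move=> Cc; have /is_cycleP[sc _ _] := Cc.
have [x xc] : exists x, x \in c by case: (c) sc => // x *; exists x; rewrite mem_head.
have /adjP[k Gk] := cycle_edges_adj Cc xc.
apply/eqP => /rowP/(_ k); rewrite (cycle_vecE Cc xc Gk) mxE => /eqP.
by rewrite (negPf (side_neq0 x)).
Qed.

Lemma cycle_vec_bound c k : is_cycle G c -> (absz (cycle_vec c 0%R k) <= 1)%N.
Proof.
move=> Cc; have [/eqP->//|] := boolP (cycle_vec c 0 k == 0).
rewrite cycle_vec_eq0 // negbK => /mapP[x xc Gk].
by rewrite (cycle_vecE Cc xc Gk) /side; case: ifP.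
Qed.

(** Signs alternate along the cycle, so positions of equal parity carry equal entries; [s] is the
    sign of the first vertex. *)
Lemma cycle_vec_parity c : is_cycle G c -> exists2 s : int, s != 0 &
  forall k, G k \in cycle_edges c ->
    cycle_vec c 0 k = (-1) ^+ odd (index (G k) (cycle_edges c)) * s.
Proof.
case: c => [/is_cycleP[]//|a p] Cc; exists (side a); first exact: side_neq0.
move=> k Gk; set j := index _ _.
have lt_j : (j < size (a :: p))%N.
  by rewrite -(size_map (fun x => [set x; next (a :: p) x]%SET)) index_mem.
have Gkj : G k = [set nth a (a :: p) j; next (a :: p) (nth a (a :: p) j)]%SET.
  by rewrite -[LHS](nth_index finset.set0 Gk) (nth_map a).
rewrite (cycle_vecE Cc (mem_nth _ lt_j) Gkj) signr_odd {Gkj}.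
have {Cc} /is_cycleP[_ + _] := Cc; rewrite /= rcons_path => /andP[/(pathP a) adj_ap _].
elim: (j) lt_j => [|i IHi] lt_i; first by rewrite mul1r.
by rewrite /= (side_adj (adj_ap i lt_i)) IHi ?exprS ?mulN1r ?mulNr // ltnW.
Qed.

(** An arc from i to j is an edge carrying positive flow out of i. Conservation of flow continues
    every arc, and a walk along arcs in a finite graph must close up. *)
Lemma exists_conformal_cycle v : relation_lattice G v -> v != 0 ->
  exists2 c, is_cycle G c & conformal (cycle_vec c) v.
Proof.
move=> Lv v0.
pose arc i j := [exists k, (G k == [set i; j]%SET) && (0 < side i * v 0 k)].
have arcP i j : reflect (exists2 k, G k = [set i; j]%SET & 0 < side i * v 0 k) (arc i j).
  apply: (iffP existsP) => [[k /andP[/eqP]]|[k Gk vk]]; first by exists k.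
  by exists k; rewrite Gk eqxx.
have arc_adj i j : arc i j -> adj G i j.
  by case/arcP => k Gk _; apply/adjP; exists k.
have arc_anti i j : arc i j -> ~~ arc j i.
  move=> ij; apply/negP => /arcP[l Gl vl]; have := side_adj (arc_adj _ _ ij).
  have /arcP[k Gk vk] := ij.
  have kl : k = l by apply: (@edge_inj _ _ G); rewrite Gk Gl finset.setUC.
  by move=> E; move: vl; rewrite E mulNr oppr_gt0 -kl ltNge ltW.
(* The default [j] is not taken at the head of an arc, by [arc_next]. *)
pose f j := odflt j [pick l | arc j l].
have arc_next i j : arc i j -> arc j (f j).
  move=> ij; have /arcP[k Gk vk] := ij; rewrite /f; case: pickP => //= no.
  have /relation_latticeP/rowP/(_ j) := Lv; rewrite !mxE => /eqP.
  rewrite -(inj_eq (mulfI (side_neq0 j))) mulr0 => /eqP sum0; exfalso.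
  (* If no arc left j, every term of the balance at j would be at most 0, while the arc from i makes
     one term negative. *)
  have le0 l : side j * (v 0 l * incidence G l j) <= 0.
    rewrite mxE; have [jGl|] := boolP (j \in G l); last by rewrite !mulr0.
    have [z jz Gl] := edge_endpoint jGl; rewrite mulr1 leNgt; apply/negP => vl.
    by have /arcP[] := no z; exists l.
  have : side j * (v 0 k * incidence G k j) < 0.
    rewrite mxE Gk !inE eqxx orbT mulr1 (side_adj (arc_adj _ _ ij)) mulNr.
    by rewrite oppr_lt0.
  rewrite ltNge => /negP[]; rewrite -sum0 mulr_sumr (bigD1 k) //= gerDl.
  by apply: sumr_le0 => l _; apply: le0.
have [i0 [j0 ij0]] : exists i j, arc i j.
  have [k vk] : exists k, v 0 k != 0.
    apply: contrapT => H; case/eqP: v0; apply/rowP => k; rewrite mxE.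
    by apply: contrapT => /eqP wk; apply: H; exists k.
  have /eqP/cards2P[a [b] [ab Gk]] := card_edge G k.
  have sba : side b = - side a by apply/side_adj/adjP; exists k.
  have : side a * v 0 k != 0 by rewrite mulf_neq0 ?side_neq0.
  rewrite neq_lt => /orP[] vk0; last by exists a, b; apply/arcP; exists k.
  exists b, a; apply/arcP; exists k; first by rewrite finset.setUC.
  by rewrite sba mulNr oppr_gt0.
have arc_iter t : arc (iter t f j0) (iter t.+1 f j0).
  by elim: t => [|t IHt] /=; [apply: arc_next ij0 | apply: arc_next IHt].
(* The orbit of j0 has a tail of length [s]; what follows it is periodic and is the desired
   cycle. *)
have [s lt_s iter_s] : exists2 s, (s < fingraph.order f j0)%N
    & iter (fingraph.order f j0) f j0 = iter s f j0.
  by apply/trajectP; have := looping_order f j0.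
pose N := (fingraph.order f j0 - s)%N; pose y := iter s f j0.
have defN : fingraph.order f j0 = (s + N)%N by rewrite /N subnKC // ltnW.
have N_gt0 : (0 < N)%N by rewrite subn_gt0.
pose c := traject f y N.
have fc : fcycle f c.
  have : iter N f y = y by rewrite /y -iterD addnC -defN.
  rewrite /c; case: (N) N_gt0 => // N1 _ def_y.
  by rewrite trajectS /= -{3}def_y iterSr -trajectSr fpath_traject.
have cE x : x \in c -> arc x (f x).
  by case/trajectP => t _ ->; rewrite /y -iterD; apply: arc_iter.
have Uc : uniq c.
  have := orbit_uniq f j0; rewrite /orbit defN.
  by rewrite -[traject f j0 _]/(traject _ _ _) trajectD cat_uniq => /and3P[].
have nextc x : x \in c -> next c x = f x by apply: nextE.
have Cc : is_cycle G c.
  apply/is_cycleP; split=> //; last first.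
    by apply: cycle_from_next => // x xc; rewrite nextc //; apply/arc_adj/cE.
  have yc : y \in c by apply/trajectP; exists 0%N.
  have fyc : f y \in c by rewrite -nextc // mem_next.
  (* Length at most two would give f (f y) = y, that is, two opposite arcs on one edge. *)
  rewrite size_traject ltnNge; apply/negP => N_le2.
  have : f (f y) = y.
    move: fc N_le2 N_gt0; rewrite /c; case: (N) => [|[|[|]]] //=.
      by rewrite andbT => /eqP fy; rewrite !fy.
    by case/and3P=> _ /eqP.
  move=> ffy; have := arc_anti _ _ (cE _ yc).
  by have := cE _ fyc; rewrite ffy => ->.
exists c => // k.
have [/eqP->|] := boolP (cycle_vec c 0 k == 0).
  by rewrite lexx /= andbT le_total.
rewrite cycle_vec_eq0 // negbK => /mapP[x xc Gk].
rewrite (cycle_vecE Cc xc Gk).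
have /arcP[l Gl vl] := cE _ xc.
have kl : k = l by apply: (@edge_inj _ _ G); rewrite Gk Gl nextc.
by move: vl; rewrite -kl /side; case: ifP => _; rewrite ?mul1r ?mulN1r; lia.
Qed.

End Bipartite.

(* The rows of B are a Z-basis of the kernel of M, and v *m C is the vector of
   coordinates of v in it; both come from the Smith normal form. *)
Lemma int_kernel_basis n m (M : 'M[int]_(n, m)) :
  exists r (B : 'M[int]_(r, n)) (C : 'M[int]_(n, r)),
    [/\ B *m C = 1%:M, B *m M = 0
      & forall v : 'rV_n, v *m M = 0 -> v = v *m C *m B].
Proof.
have [L Lu [R Ru [d _ def_M]]] := int_Smith_normal_form M.
set D := (X in L *m X *m R) in def_M.
pose S := [pred i : 'I_n | row i D == 0].
pose f : 'I_#|S| -> 'I_n := enum_val.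
pose E : 'M[int]_(#|S|, n) := \matrix_(s, i) (f s == i)%:R.
have ED (k : nat) (X : 'M_(n, k)) s : row s (E *m X) = row (f s) X.
  apply/rowP => j; rewrite !mxE (bigD1 (f s)) //= big1 => [|i fsi].
    by rewrite !mxE eqxx mul1r addr0.
  by rewrite !mxE eq_sym (negPf fsi) mul0r.
exists #|S|, (E *m invmx L), (L *m E^T); split.
- rewrite !mulmxA mulmxKV //; apply/row_matrixP => s; rewrite ED.
  by apply/rowP => t; rewrite !mxE (inj_eq enum_val_inj) eq_sym.
- rewrite def_M !mulmxA mulmxKV //; apply/row_matrixP => s.
  by rewrite row_mul ED (eqP (enum_valP s)) mul0mx row0.
move=> v; rewrite def_M !mulmxA => /(congr1 (mulmx^~ (invmx R))).
rewrite mul0mx mulmxK // => uD.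
rewrite -[LHS](mulmxK Lu); congr (_ *m _); move: (v *m L) uD => u uD.
apply/rowP => i; rewrite mxE.
have [Si|Si] := boolP (i \in S).
  have Ei j : E (enum_rank_in Si i) j = (i == j)%:R.
    by rewrite mxE /f enum_rankK_in.
  rewrite (bigD1 (enum_rank_in Si i)) //= big1 => [|s si].
    rewrite addr0 Ei eqxx mulr1 mxE (bigD1 i) //= big1 => [|j ji].
      by rewrite mxE Ei eqxx mulr1 addr0.
    by rewrite mxE Ei eq_sym (negPf ji) mulr0.
  rewrite [E s i]mxE; case: eqP => [fs|]; last by rewrite mulr0.
  by case/eqP: si; apply: enum_val_inj; rewrite enum_rankK_in.
rewrite big1 => [|s _]; last first.
  rewrite [E s i]mxE; case: eqP => [fs|]; last by rewrite mulr0.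
  by case/negP: Si; rewrite -fs enum_valP.
have [j Dij] : exists j, D i j != 0.
  apply: contrapT => H; case/eqP: Si; apply/rowP => j; rewrite !mxE.
  by apply: contrapT => /eqP Dij; apply: H; exists j; rewrite mxE.
have ij : i = j :> nat.
  have [//|ij] := eqVneq (i : nat) j.
  by move: Dij; rewrite mxE (negPf ij) mulr0n eqxx.
have /rowP/(_ j) := uD; rewrite !mxE (bigD1 i) //= big1 => [|k ki].
  rewrite addr0 => /eqP; rewrite mulf_eq0 (negPf Dij) orbF => /eqP.
  by [].
rewrite [D k j]mxE -ij; case: eqP => [/ord_inj|_]; last by rewrite mulr0.
by move=> E'; rewrite E' eqxx in ki.
Qed.

(** * Cycles through or avoiding given edges *)

Section BipartiteLattice.
Context (m n : nat) (G : graph m n) (A : {set 'I_m}).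
Hypothesis bipA : forall i j, adj G i j -> (i \in A) != (j \in A).
Implicit Types (c : seq 'I_m) (v w : 'rV[int]_n).

Lemma relation_lattice_cycle_ind (P : 'rV[int]_n -> Prop) :
    P 0 ->
    (forall c v, is_cycle G c -> relation_lattice G v ->
      conformal (cycle_vec G A c) (cycle_vec G A c + v) -> P v ->
      P (cycle_vec G A c + v)) ->
  forall v, relation_lattice G v -> P v.
Proof.
move=> P0 PD; apply: (@conformal_ind _ _
  (fun w => exists2 c, is_cycle G c & w = cycle_vec G A c)) => //.
- exact: relation_lattice_is_lattice.
- move=> v Lv v0; have [c Cc cv] := exists_conformal_cycle bipA Lv v0.
  exists (cycle_vec G A c); split=> //; first by exists c.
    exact: cycle_vec_lattice.
  exact: cycle_vec_neq0.
by move=> w v [c Cc ->] _; apply: PD.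
Qed.

(** Conformal summands are 0 wherever [v] is, so every cycle of the decomposition avoids [f], while
    one of them must use [e]. *)
Lemma exists_cycle_through_avoiding v e f :
    relation_lattice G v -> v 0 e != 0 -> v 0 f = 0 ->
  exists2 c, is_cycle G c & (G e \in cycle_edges c) && (G f \notin cycle_edges c).
Proof.
move: v; apply: relation_lattice_cycle_ind => [|c v Cc Lv cv IHv ve vf].
  by rewrite mxE eqxx.
have cf := conformal_eq0 cv vf.
have [ce|ce] := eqVneq (cycle_vec G A c 0 e) 0.
  by apply: IHv; move: ve vf; rewrite !mxE ce cf !add0r.
exists c => //; rewrite -!(@cycle_vec_eq0 _ _ _ A) //.
by rewrite -[G e \in _]negbK -(@cycle_vec_eq0 _ _ _ A) // ce cf eqxx.
Qed.

Lemma exists_cycle_through v e : relation_lattice G v -> v 0 e != 0 ->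
  exists2 c, is_cycle G c & G e \in cycle_edges c.
Proof.
move: v; apply: relation_lattice_cycle_ind => [|c v Cc Lv cv IHv ve].
  by rewrite mxE eqxx.
have [ce|ce] := eqVneq (cycle_vec G A c 0 e) 0.
  by apply: IHv; move: ve; rewrite !mxE ce !add0r.
by exists c => //; rewrite -[G e \in _]negbK -(@cycle_vec_eq0 _ _ _ A).
Qed.

Lemma exists_induced_cycle_through v e : relation_lattice G v -> v 0 e != 0 ->
  exists2 c, induced_cycle G c & G e \in cycle_edges c.
Proof.
move=> Lv /(exists_cycle_through Lv)[c Cc ec].
apply: (exists_induced_cycle (P := fun c => G e \in cycle_edges c)) Cc ec.
by move=> c1 c2 c3 ->.
Qed.

(** Containing [e] but not [f] is not additive modulo 2, but containing exactly one of them is; so a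
    separating cycle yields an induced one. *)
Lemma induced_cycles_separate v e f :
    (forall c, induced_cycle G c ->
       (G e \in cycle_edges c) = (G f \in cycle_edges c)) ->
  relation_lattice G v -> v 0 f = 0 -> v 0 e = 0.
Proof.
move=> ef Lv vf; apply: contrapT => /eqP ve.
have [c Cc /andP[ec fc]] := exists_cycle_through_avoiding Lv ve vf.
pose P c := (G e \in cycle_edges c) (+) (G f \in cycle_edges c).
have [c1 c2 c3 H||c' Ic'] := @exists_induced_cycle _ _ G P _ c Cc.
- by rewrite /P !H -!addbA; congr (_ (+) _); rewrite addbCA.
- by rewrite /P ec (negPf fc).
by rewrite /P (ef _ Ic') addbb.
Qed.

(** The combination v_f w - w_f v has entry 0 at [f], hence at [e]. *)
Lemma coord_proportional e f w v :
    (forall v, relation_lattice G v -> v 0 f = 0 -> v 0 e = 0) ->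
    relation_lattice G v -> relation_lattice G w ->
  v 0 f * w 0 e = w 0 f * v 0 e.
Proof.
move=> ef /relation_latticeP Lv /relation_latticeP Lw; apply/eqP; rewrite -subr_eq0.
have := ef (v 0 f *: w - w 0 f *: v).
rewrite !mxE => /(_ _ _)/eqP; apply; last by rewrite mulrC subrr.
by apply/relation_latticeP; rewrite mulmxBl -!scalemxAl Lv Lw !scaler0 subrr.
Qed.

End BipartiteLattice.

(** * Lattice ideals *)

Section Ideals.
Context (R : comPzRingType).
Implicit Types (X Y : set R) (p q : R).
Local Open Scope classical_set_scope.

Lemma ideal_gen0 X : ideal_gen X 0.
Proof. by have [] := submodule_gen_closed (X : set R^o). Qed.

Arguments ideal_gen0 X : clear implicits.

Lemma ideal_genMD X p q r :
  ideal_gen X q -> ideal_gen X r -> ideal_gen X (p * q + r).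
Proof. by have [_ H] := submodule_gen_closed (X : set R^o); apply: H. Qed.

Arguments ideal_genMD {X} p {q r} _ _.

Lemma ideal_genM X p q : ideal_gen X q -> ideal_gen X (p * q).
Proof. by move=> Xq; have := ideal_genMD p Xq (ideal_gen0 X); rewrite addr0. Qed.

Arguments ideal_genM {X} p {q} _.

Lemma ideal_gen_incl X p : X p -> ideal_gen X p.
Proof. by move=> Xp M [_]; apply. Qed.

Lemma ideal_gen_ind X (I : R -> Prop) :
    I 0 -> (forall p q r, I q -> I r -> I (p * q + r)) ->
    (forall p, X p -> I p) ->
  forall p, ideal_gen X p -> I p.
Proof. by move=> I0 ID XI p; apply. Qed.

Lemma ideal_gen_sub X Y : X `<=` ideal_gen Y -> ideal_gen X `<=` ideal_gen Y.
Proof.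
by move=> XY; exact: (@ideal_gen_ind X _ (ideal_gen0 Y) (@ideal_genMD Y) XY).
Qed.

End Ideals.
Arguments ideal_gen0 {R} X.
Arguments ideal_genMD {R X} p {q r} _ _.
Arguments ideal_genM {R X} p {q} _.
Arguments ideal_gen_incl {R X p} _.
Arguments ideal_gen_ind {R X I} _ _ _ {p} _.
Arguments ideal_gen_sub {R X Y} _.


Section Binomials.
Context (K : fieldType).

Definition pos_part n (v : 'rV[int]_n) : 'X_{1..n} :=
  [multinom (if (0 <= v 0 i)%R then absz (v 0%R i) else 0)%N | i < n].

Lemma lattice_binomialE n (v : 'rV[int]_n) :
  lattice_binomial K v = 'X_[pos_part v] - 'X_[pos_part (- v)].
Proof.
rewrite /lattice_binomial !mpolyXE_id big_mkcond [X in _ - X]big_mkcond.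
congr (_ - _); apply: eq_bigr => i _; rewrite mnmE ?mxE ?oppr_ge0; case: ifP => //.
by rewrite abszN.
Qed.

(** The truncated subtraction is exact: a - b = w with a, b >= 0 gives a >= w^+. *)
Lemma binomial_mul n (a b : 'X_{1..n}) (w : 'rV[int]_n) :
    (forall i, (a i)%:Z - (b i)%:Z = w 0 i) ->
  'X_[a] - 'X_[b] = 'X_[a - pos_part w] * lattice_binomial K w.
Proof.
move=> abw; rewrite lattice_binomialE mulrBr -!mpolyXD.
congr ('X_[_] - 'X_[_]); apply/mnmP => i; rewrite mnmDE mnmBE !mnmE ?mxE;
   move: (a i) (b i) (w 0 i) (abw i) => p q r; clear;
   do ?case: ifP; lia.
Qed.

(** The monomial with exponent z = (u + w)^+ - w is inserted between the two monomials of the sum: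
    one step is a multiple of f_w, the other of f_u. The sign condition says that z >= 0; it is not
    symmetric in [u] and [w]. *)
Lemma lattice_binomialD n (u w : 'rV[int]_n) :
    (forall i, ~~ ((u 0 i < 0) && (0 < w 0 i))) ->
  exists p q, lattice_binomial K (u + w) =
              p * lattice_binomial K u + q * lattice_binomial K w.
Proof.
move=> uw; rewrite lattice_binomialE.
pose z : 'X_{1..n} := [multinom absz ((pos_part (u + w)%R i)%:Z - w 0 i)%R | i < n].
rewrite -['X_[pos_part (u + w)]](subrK 'X_[z]) -addrA addrC.
rewrite (binomial_mul (w := u)) => [|i]; last first.
  rewrite !mnmE !mxE; move: (u 0 i) (w 0 i) (uw i) => p q; clear.
  by do 2!case: ifP; lia.
rewrite (binomial_mul (a := pos_part (u + w)) (w := w)) => [|i]; last first.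
  rewrite !mnmE !mxE; move: (u 0 i) (w 0 i) (uw i) => p q; clear.
  by case: ifP; lia.
by eexists; eexists.
Qed.

Lemma lattice_binomial0 n : lattice_binomial K (0 : 'rV_n) = 0.
Proof. by rewrite lattice_binomialE oppr0 subrr. Qed.

Lemma ideal_gen_binomialD n X (u w : 'rV[int]_n) :
    (forall i, ~~ ((u 0 i < 0) && (0 < w 0 i))) ->
    ideal_gen X (lattice_binomial K u) -> ideal_gen X (lattice_binomial K w) ->
  ideal_gen X (lattice_binomial K (u + w)).
Proof.
move=> uw Xu Xw; have [p [q ->]] := lattice_binomialD uw.
exact (ideal_genMD p Xu (ideal_genM q Xw)).
Qed.

Lemma lattice_idealP n (L : set 'rV[int]_n) (a b : 'X_{1..n}) (w : 'rV[int]_n) :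
    L w -> (forall i, (a i)%:Z - (b i)%:Z = w 0 i) ->
  lattice_ideal K L ('X_[a] - 'X_[b]).
Proof.
move=> Lw /binomial_mul->; refine (ideal_genM _ (ideal_gen_incl _)).
by exists w.
Qed.

Hypothesis charK : [pchar K]%R =i pred0.

Lemma intr_char0_eq0 (z : int) : (z%:~R == 0 :> K) = (z == 0).
Proof.
have n0 (k : nat) : (k%:R == 0 :> K) = (k == 0)%N by rewrite ((pcharf0P K).1 charK).
by case: z => k; rewrite ?NegzE ?mulrNz ?oppr_eq0 -pmulrn n0.
Qed.

Lemma exprz2_eq1 (z : int) : ((2%:R : K) ^ z == 1) = (z == 0).
Proof.
have two k : ((2%:R : K) ^+ k == 1) = (k == 0)%N.
  rewrite -natrX -subr_eq0 -(natrB _ (expn_gt0 2 k)).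
  rewrite ((pcharf0P K).1 charK) subn_eq0.
  by case: k => // k; rewrite leqNgt -{1}(expn0 2) ltn_exp2l.
case: z => k; first by rewrite two.
by rewrite NegzE -exprnN invr_eq1 two oppr_eq0.
Qed.

(* Evaluate at the point whose i-th coordinate is 2 ^ (g i). *)
Lemma ideal_gen_weight n (X : set 'rV[int]_n) (g : 'I_n -> int) (v : 'rV[int]_n) :
    (forall w, X w -> \sum_i g i * w 0 i = 0) ->
    ideal_gen [set lattice_binomial K w | w in X]%classic (lattice_binomial K v) ->
  \sum_i g i * v 0 i = 0.
Proof.
pose pt i : K := 2%:R ^ (g i).
have two0 : (2%:R : K) != 0 by rewrite ((pcharf0P K).1 charK).
have evX (a : 'X_{1..n}) : ('X_[a] : {mpoly K[n]}).@[pt] = 2%:R ^ (\sum_i g i * (a i)%:Z).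
  rewrite mevalX (big_morph _ (fun x y => expfzDr x y two0) (expr0z _)).
  by apply: eq_bigr => i _; rewrite /pt exprnP exprz_exp.
have evB w : ((lattice_binomial K w).@[pt] == 0) = (\sum_i g i * w 0 i == 0).
  rewrite lattice_binomialE mevalB !evX.
  have -> : \sum_i g i * w 0 i = \sum_i g i * (pos_part w i)%:Z
                               - \sum_i g i * (pos_part (- w) i)%:Z.
    rewrite -sumrB; apply: eq_bigr => i _; rewrite -mulrBr; congr (_ * _).
    rewrite !mnmE mxE; move: (w 0 i) => z.
    by do 2!case: ifP; lia.
  set s := \sum_i _; set t := \sum_i _.
  rewrite -[s in LHS](subrK t) expfzDr // -{2}[_ ^ t]mul1r -mulrBl mulf_eq0.
  by rewrite (negPf (expfz_neq0 t two0)) orbF subr_eq0 exprz2_eq1.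
move=> Xg Iv; apply/eqP; rewrite -evB; apply/eqP; move: Iv.
apply: (@ideal_gen_ind _ _ (fun p : {mpoly K[n]} => p.@[pt] = 0))
  => [|p q r q0 r0|_ [w /Xg/eqP + <-]].
- exact: meval0.
- by rewrite mevalD mevalM q0 r0 mulr0 addr0.
- by rewrite -evB => /eqP.
Qed.

End Binomials.

(** * Identifying the last variable with x_e *)

Section IdentifyLast.
Context (K : fieldType) (n : nat) (e : 'I_n).
Local Notation pi := (@identify_last K n e).

Definition fold_mon (a : 'X_{1..n.+1}) : 'X_{1..n} :=
  [multinom (a (lift ord_max l) + (if l == e then a ord_max else 0))%N | l < n].

Lemma identify_lastX a : pi 'X_[a] = 'X_[fold_mon a].
Proof.
rewrite /identify_last comp_mpolyX (bigD1_ord ord_max) //= tnth_mktuple unlift_none.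
have -> : fold_mon a = (U_(e) *+ a ord_max + [multinom a (lift ord_max l) | l < n])%MM.
  apply/mnmP => l; rewrite mnmDE mulmnE !mnmE addnC eq_sym; congr addn.
  by case: eqP; rewrite ?mul1n ?mul0n.
rewrite mpolyXD -mpolyXn; congr (_ * _); rewrite [RHS]mpolyXE_id.
by apply: eq_bigr => l _; rewrite tnth_mktuple liftK mnmE.
Qed.

Lemma identify_lastMD p q r : pi (p * q + r) = pi p * pi q + pi r.
Proof. by rewrite /identify_last comp_mpolyD (rmorphM (comp_mpoly _)). Qed.

Lemma identify_lastD p q : pi (p + q) = pi p + pi q.
Proof. exact: comp_mpolyD. Qed.

Lemma identify_lastB p q : pi (p - q) = pi p - pi q.
Proof. exact: comp_mpolyB. Qed.

Lemma identify_last_surj p : exists q, pi q = p.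
Proof.
elim/mpolyind: p => [|c a p _ _ [q <-]]; first by exists 0; apply: comp_mpoly0.
exists (c *: 'X_[[multinom (if unlift ord_max j is Some l then a l else 0%N) | j < n.+1]] + q).
rewrite identify_lastD; congr (_ + _).
rewrite /identify_last comp_mpolyZ -/(pi _) identify_lastX; congr (_ *: 'X_[_]).
apply/mnmP => l; rewrite !mnmE liftK unlift_none.
by case: ifP; rewrite addn0.
Qed.

(** The linear map induced by [identify_last] on exponent vectors. *)
Definition fold_mx : 'M[int]_(n.+1, n) :=
  \matrix_(j, l) (if unlift ord_max j is Some k then k == l else e == l)%:R.

Lemma fold_mxE (u : 'rV[int]_n.+1) l :
  (u *m fold_mx) 0 l = u 0 (lift ord_max l) + (l == e)%:R * u 0 ord_max.
Proof.
rewrite mxE (bigD1_ord ord_max) //= mxE unlift_none eq_sym addrC mulrC.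
congr (_ + _); rewrite (bigD1 l) //= mxE liftK eqxx mulr1 big1 ?addr0 // => k kl.
by rewrite mxE liftK (negPf kl) mulr0.
Qed.

Lemma fold_mon_pos_part (u : 'rV[int]_n.+1) l :
  (fold_mon (pos_part u) l)%:Z - (fold_mon (pos_part (- u)) l)%:Z
    = (u *m fold_mx) 0 l.
Proof.
rewrite fold_mxE !mnmE !mxE; case: eqP => _.
  by move: (u 0 _) (u 0 _) => x y; do ?case: ifP; lia.
by move: (u 0 _) (u 0 _) => x y; do ?case: ifP; lia.
Qed.

Lemma identify_last_binomial (L : set 'rV_n) (u : 'rV[int]_n.+1) :
  L (u *m fold_mx) -> lattice_ideal K L (pi (lattice_binomial K u)).
Proof.
move=> Lu; rewrite lattice_binomialE identify_lastB !identify_lastX.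
by apply: lattice_idealP Lu _ => l; rewrite fold_mon_pos_part.
Qed.

(** In general the image is only a monomial multiple of the right-hand side, since opposite signs at
    x_e and x_{n+1} create a common factor. A zero entry at one of the two prevents this. *)
Lemma identify_last_binomialE (u : 'rV[int]_n.+1) :
    u 0 (lift ord_max e) = 0 \/ u 0 ord_max = 0 ->
  pi (lattice_binomial K u) = lattice_binomial K (u *m fold_mx).
Proof.
move=> u0; rewrite !lattice_binomialE identify_lastB !identify_lastX.
have u0' : (- u) 0 (lift ord_max e) = 0 \/ (- u) 0 ord_max = 0.
  by rewrite !mxE; case: u0 => ->; rewrite oppr0; [left | right].
have fold (w : 'rV_n.+1) : w 0 (lift ord_max e) = 0 \/ w 0 ord_max = 0 ->
    fold_mon (pos_part w) = pos_part (w *m fold_mx).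
  move=> w0; apply/mnmP => l; rewrite !mnmE fold_mxE.
  have [->|_] := eqVneq l e; last by rewrite mul0r addr0 addn0.
  by rewrite mul1r; case: w0 => ->; rewrite ?add0r ?addr0 ?add0n ?addn0.
by rewrite !fold // mulNmx.
Qed.

End IdentifyLast.

Section MinimalGenerators.
Context (K : fieldType).

(** A generating subset of least cardinality is irredundant. *)
Lemma exists_min_gens (n : nat) (L : set 'rV[int]_n) (F : finType)
    (vec : F -> 'rV[int]_n) (S : {set F}) :
    (forall t, t \in S -> L (vec t)) ->
    ideal_gen [set lattice_binomial K (vec t) | t in [set t | t \in S]]%classic
      = lattice_ideal K L ->
  exists s (W : 'M[int]_(s, n)), min_gens K L W.
Proof.
pose gen (X : {set F}) :=
  ideal_gen [set lattice_binomial K (vec t) | t in [set t | t \in X]]%classic.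
move=> LS; rewrite -/(gen S) => genS.
pose good (X : {set F}) := (X \subset S) && `[< gen X = lattice_ideal K L >].
have goodS : good S by rewrite /good subxx; apply/asboolP.
case: (arg_minnP (fun X : {set F} => #|X|) goodS) => X /andP[XS /asboolP genX] minX.
pose W : 'M[int]_(#|X|, n) := \matrix_s vec (enum_val s).
have rowW s : row s W = vec (enum_val s) by rewrite rowK.
have WE (P : set 'I_#|X|) (Y : {set F}) :
    (forall s, P s <-> enum_val s \in Y) -> Y \subset X ->
  [set lattice_binomial K (row j W) | j in P]%classic =
  [set lattice_binomial K (vec t) | t in [set t | t \in Y]]%classic.
  move=> PY YX; apply/seteqP; split=> [_ [j Pj <-]|_ [t /= tY <-]].
    by exists (enum_val j); rewrite ?rowW //=; apply/PY.
  have tX := fintype.subsetP YX t tY.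
  by exists (enum_rank_in tX t); rewrite ?rowW ?PY enum_rankK_in.
exists #|X|, W; split.
- by move=> j; rewrite rowW; apply: LS; apply: (fintype.subsetP XS); apply: enum_valP.
- by rewrite -genX (WE _ X) // => s; split=> // _; apply: enum_valP.
move=> k genk; have := minX (X :\ enum_val k)%SET.
rewrite [leqLHS](cardsD1 (enum_val k)) enum_valP add1n ltnn => H.
suff /H : good (X :\ enum_val k)%SET by [].
rewrite /good (fintype.subset_trans (subD1set _ _) XS) /=; apply/asboolP.
rewrite -genk /gen -(WE [set~ k]%classic) ?subD1set // => s.
by rewrite !inE enum_valP andbT (inj_eq enum_val_inj) /=; split=> /eqP.
Qed.

End MinimalGenerators.

(** * Splitting an edge along a set of vertices *)

Lemma int_row_free_mul1 r n (B : 'M[int]_(r, n)) (C : 'M[int]_(n, r)) :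
  B *m C = 1%:M -> int_row_free B.
Proof.
move=> BC; apply/row_freeP; exists (map_mx intr C).
by rewrite -map_mxM BC map_mx1.
Qed.

Lemma int_row_free_col2 s (a b : 'I_s -> int) :
    (forall c d : int, (forall j, c * a j + d * b j = 0) -> c = 0 /\ d = 0) ->
  int_row_free (col_mx (\row_j a j) (\row_j b j)).
Proof.
move=> indep; rewrite /int_row_free -kermx_eq0; apply: contraT => /rowV0Pn[w].
move/sub_kermxP => wM w0.
pose c : rat := w 0 (lshift 1 0); pose d : rat := w 0 (rshift 1 0).
have cd j : c * (a j)%:~R + d * (b j)%:~R = 0.
  have /rowP/(_ j) := wM; rewrite map_col_mx -[w]hsubmxK mul_row_col !mxE.
  by rewrite !big_ord1 !mxE.
(* Denominators are cleared: both rational coefficients are multiplied by [denq c * denq d]. *)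
have [j|c0 d0] := indep (numq c * denq d) (numq d * denq c).
  apply/eqP; rewrite -(intr_eq0 rat) rmorphD !rmorphM /= !numqE; apply/eqP.
  transitivity ((denq c)%:~R * (denq d)%:~R * (c * (a j)%:~R + d * (b j)%:~R)).
    by ring.
  by rewrite cd mulr0.
case/eqP: w0; apply/rowP => i; rewrite mxE.
move/eqP: c0; rewrite mulf_eq0 (negPf (denq_neq0 _)) orbF numq_eq0 => /eqP c0.
move/eqP: d0; rewrite mulf_eq0 (negPf (denq_neq0 _)) orbF numq_eq0 => /eqP d0.
by case: (split_ordP i) => k ->; rewrite ord1.
Qed.

Section Separation.
Context (K : fieldType) (charK : [pchar K]%R =i pred0).
Context (m n : nat) (G : graph m n) (A : {set 'I_m}).
Hypothesis bipA : forall i j, adj G i j -> (i \in A) != (j \in A).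
Context (e : 'I_n) (x y : 'I_m) (Q : {set 'I_m}).
Hypotheses (Ge : G e = [set x; y]%SET) (xNQ : x \notin Q) (yNQ : y \notin Q).
Hypothesis closedQ : forall i j, adj G i j -> i \in Q ->
  [|| j \in Q, j == x | j == y].
Implicit Types (u v w : 'rV[int]_n).

Local Notation inc := (incidence G).
Local Notation L := (relation_lattice G).

Definition meets (k : 'I_n) := [exists i in Q, i \in G k].

(** The sign makes the flux the value that [e] must take to balance, at [y], the edges meeting [Q].
    As a column it lets the rerouting be a matrix. *)
Definition flux_col : 'cV[int]_n := \col_k - (meets k && (y \in G k))%:R.

Definition flux v : int := (v *m flux_col) 0 0.

Lemma fluxE v : flux v = - \sum_(k | meets k && (y \in G k)) v 0 k.
Proof.
rewrite /flux mxE [in RHS]big_mkcond -sumrN; apply: eq_bigr => k _; rewrite mxE.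
by case: ifP => _; rewrite ?oppr0 ?mulr0 ?mulrN1.
Qed.

Lemma eNmeets : ~~ meets e.
Proof.
apply/existsP => -[i /andP[iQ]]; rewrite Ge !inE => /orP[]/eqP E.
  by move: xNQ; rewrite -E iQ.
by move: yNQ; rewrite -E iQ.
Qed.

(* The flow of v through Q, closed up along e. *)
Definition through v : 'rV[int]_n :=
  \row_k (if meets k then v 0 k else if k == e then flux v else 0).

Lemma side_orthogonal v : \sum_z side A z * (v *m inc) 0 z = 0.
Proof.
transitivity (\sum_k v 0 k * \sum_z inc k z * side A z).
  under eq_bigr => z _ do rewrite mxE mulr_sumr.
  rewrite exchange_big; apply: eq_bigr => k _; rewrite mulr_sumr.
  by apply: eq_bigr => z _; rewrite mulrC mulrA.
rewrite big1 // => k _; rewrite [X in _ * X](_ : _ = 0) ?mulr0 //.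
have /eqP/cards2P[a [b] [ab Gk]] := card_edge G k.
under eq_bigr => z _ do rewrite mxE mulr_natl mulrb Gk.
rewrite -big_mkcond big_setU1 ?inE //= big_set1.
have /(side_adj bipA)-> : adj G a b by apply/adjP; exists k.
by rewrite addrN.
Qed.

(** Inside [Q] the balance is that of [v], as all edges there meet [Q]; at [y] it holds by the
    choice of the flux. *)
Lemma through_lattice v : L v -> L (through v).
Proof.
move/relation_latticeP/rowP => Lv; apply/relation_latticeP.
set t := through v *m inc.
have tE z : t 0 z = \sum_(k | meets k && (z \in G k)) v 0 k + flux v * (z \in G e)%:R.
  rewrite mxE (bigD1 e) //= !mxE (negPf eNmeets) eqxx addrC; congr (_ + _).
  rewrite big_mkcond [RHS]big_mkcond; apply: eq_bigr => k _; rewrite !mxE.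
  have [->|ke] := eqVneq k e; first by rewrite (negPf eNmeets).
  by case: (meets k); case: (z \in G k); rewrite ?mulr1 ?mulr0.
have tQ z : z \notin [set x; y]%SET -> t 0 z = 0.
  move=> zxy; rewrite tE Ge (negPf zxy) mulr0 addr0.
  have [zQ|zNQ] := boolP (z \in Q).
    rewrite big_mkcond; transitivity ((v *m inc) 0 z); last by rewrite Lv mxE.
    rewrite mxE; apply: eq_bigr => k _.
    rewrite mxE; have [zGk|_] := boolP (z \in G k); last by rewrite andbF mulr0.
    by rewrite mulr1 andbT ifT //; apply/existsP; exists z; rewrite zQ.
  rewrite big1 // => k /andP[/existsP[i /andP[iQ iGk]] zGk]; exfalso.
  have zi : z != i by apply: contraNneq zNQ => ->.
  have Gk : G k = [set i; z]%SET.
    apply/eqP; rewrite eq_sym eqEcard finset.subUset !finset.sub1set iGk zGk /= card_edge.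
    by rewrite cards2 eq_sym zi.
  have iz : adj G i z by apply/adjP; exists k.
  by have := closedQ iz iQ; rewrite (negPf zNQ) /=; move: zxy; rewrite !inE => /negPf->.
have ty : t 0 y = 0 by rewrite tE fluxE Ge !inE eqxx orbT mulr1 addrN.
(* Only x is left, and orthogonality to the signs forces its balance as well. *)
have tx : t 0 x = 0.
  have := side_orthogonal (through v); rewrite -/t (bigD1 x) //= big1 => [|z zx].
    by rewrite addr0 => /eqP; rewrite mulf_eq0 (negPf (side_neq0 _ _)) => /eqP.
  have [->|zy] := eqVneq z y; first by rewrite ty mulr0.
  by rewrite tQ ?mulr0 // !inE negb_or zx.
apply/rowP => z; rewrite [RHS]mxE.
have [->//|zx] := eqVneq z x; have [->//|zy] := eqVneq z y.
by rewrite tQ // !inE negb_or zx.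
Qed.

Lemma flux_eq u v : (forall k, meets k -> u 0 k = v 0 k) -> flux u = flux v.
Proof.
by move=> uv; rewrite !fluxE; congr (- _); apply: eq_bigr => k /andP[/uv].
Qed.

Lemma flux_through v : flux (through v) = flux v.
Proof. by apply: flux_eq => k; rewrite mxE => ->. Qed.

Lemma flux0 v : (forall k, meets k -> v 0 k = 0) -> flux v = 0.
Proof.
by move=> v0; rewrite fluxE big1 ?oppr0 // => k /andP[/v0].
Qed.

(** [v] and [through v] differ by a multiple of the basis vector of [e]; it lies in L, so it is 0
    because h_e is not. *)
Lemma flux_supported v :
  L v -> (forall k, ~~ meets k -> k != e -> v 0 k = 0) -> flux v = v 0 e.
Proof.
move=> Lv v0; have Lt := through_lattice Lv.
have def_v : v = through v + (v 0 e - flux v) *: delta_mx 0 e.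
  apply/rowP => k; rewrite !mxE /=.
  have [->|ke] := eqVneq k e; first by rewrite (negPf eNmeets) mulr1 addrC subrK.
  rewrite mulr0 addr0; case: ifP => // /negbT Nk; exact: v0.
move/relation_latticeP: Lv; rewrite {1}def_v mulmxDl -scalemxAl.
have /relation_latticeP-> := Lt; rewrite add0r delta_incidence => /rowP/(_ x).
rewrite !mxE -/(h G e 0 x).
move/eqP; rewrite mulf_eq0 hE Ge !inE eqxx /= orbF subr_eq0 => /eqP->.
by [].
Qed.

(* The part of v through Q is rerouted from x_e to the new variable. *)
Definition split_mx : 'M[int]_(n, n.+1) :=
  \matrix_(k, j) (if unlift ord_max j is Some l
    then (k == l)%:R - (l == e)%:R * flux_col k 0 else flux_col k 0).

Lemma split_max v : (v *m split_mx) 0 ord_max = flux v.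
Proof.
by rewrite /flux !mxE; apply: eq_bigr => k _; rewrite !mxE unlift_none.
Qed.

Lemma split_lift v l :
  (v *m split_mx) 0 (lift ord_max l) = v 0 l - (l == e)%:R * flux v.
Proof.
rewrite /flux !mxE mulr_sumr -[X in X - _](_ : \sum_k v 0 k * (k == l)%:R = _).
  rewrite -sumrB; apply: eq_bigr => k _; rewrite !mxE liftK.
  by rewrite mulrBr; congr (_ - _); rewrite mulrCA.
rewrite (bigD1 l) //= eqxx mulr1 big1 ?addr0 // => k /negPf->.
by rewrite mulr0.
Qed.

Lemma splitK v : v *m split_mx *m fold_mx e = v.
Proof.
by apply/rowP => l; rewrite fold_mxE split_lift split_max subrK.
Qed.

Lemma split_foldK : split_mx *m fold_mx e = 1%:M.
Proof. by apply/row_matrixP => k; rewrite !rowE mulmxA splitK mulmx1. Qed.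

(** The image of L under [split_mx], described through the retraction [fold_mx e] so that the
    lattice axioms and saturation carry over from L. *)
Definition split_lattice : set 'rV[int]_n.+1 :=
  [set u | L (u *m fold_mx e) /\ u = u *m fold_mx e *m split_mx]%classic.

Lemma split_latticeP v : L v -> split_lattice (v *m split_mx).
Proof. by move=> Lv; split; rewrite splitK. Qed.

Lemma split_lattice_is_lattice : is_lattice split_lattice.
Proof.
have [L0 LB] := relation_lattice_is_lattice G.
split=> [|u v [Lu def_u] [Lv def_v]].
  by split; rewrite ?mul0mx.
by split; rewrite !mulmxBl -?def_u -?def_v //; apply: LB.
Qed.

Lemma split_lattice_saturated : saturated split_lattice.
Proof.
move=> k v k0 [Lkv def_kv]; split.
  by apply: relation_lattice_saturated k0 _; rewrite scalemxAl.
apply/rowP => j; apply: (mulfI k0).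
by have /rowP/(_ j) := def_kv; rewrite -!scalemxAl !mxE.
Qed.

(** Folding undoes splitting, so a basis with a right inverse is carried to a basis with a right
    inverse. *)
Lemma split_lattice_rank : exists2 r, has_rank L r & has_rank split_lattice r.
Proof.
have [r [B [C [BC BM kerE]]]] := int_kernel_basis inc.
have LB (c : 'rV_r) : L (c *m B) by apply/relation_latticeP; rewrite -mulmxA BM mulmx0.
have LE v : L v -> v = v *m C *m B by move/relation_latticeP/kerE.
exists r; first exists B; [exact: int_row_free_mul1 BC| |].
  by apply/seteqP; split=> [v /LE E|_ [c _ <-]]; [exists (v *m C)|].
exists (B *m split_mx).
  apply: (@int_row_free_mul1 _ _ _ (fold_mx e *m C)).
  by rewrite mulmxA -(mulmxA B) split_foldK mulmx1.
apply/seteqP; split=> [u [Lu def_u]|_ [c _ <-]].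
  by exists (u *m fold_mx e *m C) => //; rewrite mulmxA -LE.
by rewrite mulmxA; apply: split_latticeP.
Qed.


Lemma through0 v k : ~~ meets k -> k != e -> through v 0 k = 0.
Proof. by rewrite mxE => /negPf-> /negPf->. Qed.

Lemma rest0 v k : meets k -> (v - through v) 0 k = 0.
Proof. by move=> mk; rewrite !mxE mk subrr. Qed.

Lemma rest_lattice v : L v -> L (v - through v).
Proof.
by move=> Lv; apply: relation_latticeB => //; apply: through_lattice.
Qed.

Lemma throughe v : through v 0 e = flux v.
Proof. by rewrite mxE (negPf eNmeets) eqxx. Qed.

(** Splitting moves the whole [e]-entry of [through v] to the new variable, so no common factor
    arises. *)
Lemma identify_last_through v :
  identify_last e (lattice_binomial K (through v *m split_mx))
    = lattice_binomial K (through v).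
Proof.
rewrite identify_last_binomialE ?splitK //; left.
by rewrite split_lift eqxx mul1r throughe flux_through subrr.
Qed.

Lemma identify_last_rest v :
  identify_last e (lattice_binomial K ((v - through v) *m split_mx))
    = lattice_binomial K (v - through v).
Proof.
rewrite identify_last_binomialE ?splitK //; right.
by rewrite split_max; apply: flux0 => k; apply: rest0.
Qed.

(** The image of the split binomial of [v] may be a proper monomial multiple of f_v. So [v] is cut
    into [through v] and the rest, whose binomials are images, and f_v is recovered from these
    two. *)
Lemma identify_last_split_ideal :
  [set identify_last e p | p in lattice_ideal K split_lattice]%classic
    = lattice_ideal K L.
Proof.
apply/seteqP; split=> [_ [p Ip <-]|].
  move: p Ip; apply: (@ideal_gen_ind _ _ (fun p => lattice_ideal K L (identify_last e p))).
  - by rewrite /identify_last comp_mpoly0; apply: ideal_gen0.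
  - by move=> p q r Iq Ir; rewrite identify_lastMD; exact: (ideal_genMD _ Iq Ir).
  by move=> _ [u [Lu _] <-]; apply: identify_last_binomial.
set I := (X in (_ `<=` X)%classic).
have I_MD p q r : I q -> I r -> I (p * q + r).
  move=> [q' Iq' <-] [r' Ir' <-]; have [p' <-] := identify_last_surj e p.
  exists (p' * q' + r'); first exact: (ideal_genMD _ Iq' Ir').
  by rewrite identify_lastMD.
have I0 : I 0 by exists 0; [apply: ideal_gen0 | apply: comp_mpoly0].
apply: (@ideal_gen_ind _ _ I) => // _ [v Lv <-].
have I_split w (p : {mpoly K[n]}) :
    L w -> p = identify_last e (lattice_binomial K (w *m split_mx)) -> I p.
  move=> Lw ->; exists (lattice_binomial K (w *m split_mx)) => //.
  by apply: ideal_gen_incl; exists (w *m split_mx) => //; apply: split_latticeP.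
have It := I_split _ _ (through_lattice Lv) (esym (identify_last_through v)).
have Ir := I_split _ _ (rest_lattice Lv) (esym (identify_last_rest v)).
have ID p q a b : I a -> I b -> I (p * a + q * b).
  by move=> Ia Ib; apply: (I_MD) => //; rewrite -[_ * _]addr0; apply: I_MD.
have off k : k != e -> through v 0 k = 0 \/ (v - through v) 0 k = 0.
  by move=> ke; have [mk|mk] := boolP (meets k); [right; apply: rest0 | left; apply: through0].
rewrite -(subrK (through v) v).
(* The two parts overlap only at [e], so at least one order of the summands meets the sign condition
   of [lattice_binomialD]. *)
have [te|te] := boolP ((through v 0 e < 0) && (0 < (v - through v) 0 e)).
  have [k|p [q ->]] := @lattice_binomialD K _ (v - through v) (through v); last exact: ID.
  have [->|/off[]->] := eqVneq k e; rewrite ?ltxx ?andbF //.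
  by case/andP: te => te re; rewrite ltNge (ltW re).
rewrite addrC.
have [k|p [q ->]] := @lattice_binomialD K _ (through v) (v - through v); last exact: ID.
by have [->|/off[]->] := eqVneq k e; rewrite ?ltxx ?andbF.
Qed.

(** A cycle conformal to [through v] lives on [e] and the edges meeting [Q], so splitting moves its
    [e]-entry to the new variable and keeps it bounded by 1. If [through v] is 0, a cycle conformal
    to [v] has flux 0 and is only padded by a zero. *)
Lemma split_conformal (u : 'rV[int]_n.+1) : split_lattice u -> u != 0 ->
  exists w : 'rV[int]_n.+1,
    [/\ (forall j, (absz (w 0%R j) <= 1)%N), split_lattice w, w != 0 & conformal w u].
Proof.
move=> [Lu def_u]; move: (u *m fold_mx e) Lu def_u => v Lv -> {u} u0.
have [t0|t0] := eqVneq (through v) 0; last first.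
  have [c Cc cv] := exists_conformal_cycle bipA (through_lattice Lv) t0.
  have Lc := cycle_vec_lattice bipA Cc.
  have c0 := cycle_vec_neq0 A Cc.
  have cb k := cycle_vec_bound A k Cc.
  move: (cycle_vec G A c) Lc c0 cb cv => w Lw w0 wb wv.
  have fw : flux w = w 0 e.
    by apply: flux_supported => // k mk ke; apply: (conformal_eq0 wv); apply: through0.
  exists (w *m split_mx); split.
  - move=> j; case: (unliftP ord_max j) => [l ->|->]; last by rewrite split_max fw.
    rewrite split_lift fw; have [->|_] := eqVneq l e; first by rewrite mul1r subrr.
    by rewrite mul0r subr0.
  - exact: split_latticeP.
  - by apply: contraNneq w0 => E; rewrite -[w]splitK E mul0mx.
  move=> j; case: (unliftP ord_max j) => [l ->|->].
    rewrite !split_lift fw; have [->|le] := eqVneq l e.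
      by rewrite !mul1r subrr lexx /= andbT le_total.
    rewrite !mul0r !subr0; have := wv l; rewrite mxE (negPf le).
    by case: ifP => // _; case: (v 0 l) (w 0 l) => p [q|q]; clear; lia.
  by rewrite !split_max fw -throughe; apply: wv.
have r0 : v - through v != 0.
  by apply: contraNneq u0; rewrite t0 subr0 => ->; rewrite mul0mx.
have [c Cc cv] := exists_conformal_cycle bipA (rest_lattice Lv) r0.
have Lc := cycle_vec_lattice bipA Cc.
have c0 := cycle_vec_neq0 A Cc.
have cb k := cycle_vec_bound A k Cc.
move: (cycle_vec G A c) Lc c0 cb cv => w Lw w0 wb wv.
have fw : flux w = 0.
  by apply: flux0 => // k mk; apply: (conformal_eq0 wv); apply: rest0.
have fv : flux v = 0 by rewrite -throughe t0 mxE.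
exists (w *m split_mx); split.
- move=> j; case: (unliftP ord_max j) => [l ->|->]; last by rewrite split_max fw.
  by rewrite split_lift fw mulr0 subr0.
- exact: split_latticeP.
- by apply: contraNneq w0 => E; rewrite -[w]splitK E mul0mx.
move=> j; case: (unliftP ord_max j) => [l ->|->]; last first.
  by rewrite !split_max fw fv lexx.
by rewrite !split_lift fw fv !mulr0 !subr0; have := wv l; rewrite t0 subr0.
Qed.

Lemma split_min_gens : exists s (W : 'M[int]_(s, n.+1)), min_gens K split_lattice W.
Proof.
(* The elements 0, 1, 2 of ['I_3] encode the entries -1, 0, 1, which makes the set of candidate
   generators finite. *)
pose vec (t : 'rV['I_3]_n.+1) : 'rV[int]_n.+1 := \row_j ((t 0 j : nat)%:Z - 1).
pose S := [set t | `[< split_lattice (vec t) >]]%SET.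
have LS t : t \in S -> split_lattice (vec t) by rewrite inE => /asboolP.
apply: (exists_min_gens LS); apply/seteqP; split.
  by apply: ideal_gen_sub => _ [t /LS Lt <-]; apply: ideal_gen_incl; exists (vec t).
apply: ideal_gen_sub => _ [u Lu <-]; move: u Lu.
apply: (conformal_ind split_lattice_is_lattice split_conformal).
  by rewrite lattice_binomial0; apply: ideal_gen0.
move=> w v wb Lw Lv wv Iv; apply: ideal_gen_binomialD Iv => [k|].
  by have := wv k; rewrite mxE; move: (w 0 k) (v 0 k); clear; lia.
apply: ideal_gen_incl; exists (\row_j inord (absz (w 0%R j + 1)%R)).
  rewrite /= inE; apply/asboolP.
  suff -> : vec (\row_j inord (absz (w 0%R j + 1)%R)) = w by [].
  apply/rowP => j; rewrite !mxE inordK; first by have := wb j; lia.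
  by have := wb j; lia.
congr lattice_binomial.
apply/rowP => j; rewrite !mxE inordK; first by have := wb j; lia.
by have := wb j; lia.
Qed.

Lemma flux_separable v : L v -> v 0 e = 0 -> flux v != 0 -> separable_at K L e.
Proof.
move=> Lv ve fv; exists split_lattice; split.
- exact: split_lattice_is_lattice.
- exact: split_lattice_saturated.
- exact: split_lattice_rank.
- exact: identify_last_split_ideal.
have [s [W minW]] := split_min_gens; exists s, W; split=> //.
have [LW genW _] := minW.
have -> : (col ord_max W)^T = \row_j W j ord_max by apply/rowP => j; rewrite !mxE.
have -> : (col (lift ord_max e) W)^T = \row_j W j (lift ord_max e).
  by apply/rowP => j; rewrite !mxE.
apply: int_row_free_col2 => c d cd.
(* A relation between the two columns is a weight that vanishes on the generators, hence on the
   whole split lattice. The image of [through v] has entries (flux, 0) there and that of [v] has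
   (flux, -flux), so c = 0 and then d = 0. *)
pose g j : int := if unlift ord_max j is Some l then (l == e)%:R * d else c.
have gE (u : 'rV_n.+1) : \sum_j g j * u 0 j = c * u 0 ord_max + d * u 0 (lift ord_max e).
  rewrite (bigD1_ord ord_max) //= /g unlift_none; congr (_ + _).
  rewrite (bigD1 e) //= liftK eqxx mul1r big1 ?addr0 // => l /negPf le.
  by rewrite liftK le !mul0r.
have gL (u : 'rV_n.+1) : split_lattice u -> c * u 0 ord_max + d * u 0 (lift ord_max e) = 0.
  move=> Lu; rewrite -gE.
  apply: (ideal_gen_weight charK (X := [set row j W | j in [set: 'I_s]]%classic)).
    by move=> _ [j _ <-]; rewrite gE !mxE.
  rewrite image_comp.
  rewrite -[ideal_gen _]/(ideal_gen
    [set lattice_binomial K (row j W) | j in _]%classic) genW.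
  by apply: ideal_gen_incl; exists u.
have := gL _ (split_latticeP (through_lattice Lv)).
rewrite split_max split_lift throughe flux_through eqxx mul1r subrr mulr0 addr0.
move/eqP; rewrite mulf_eq0 (negPf fv) orbF => /eqP c0.
have := gL _ (split_latticeP Lv).
rewrite split_max split_lift ve eqxx mul1r c0 mul0r !add0r mulrN => /eqP.
by rewrite oppr_eq0 mulf_eq0 (negPf fv) orbF => /eqP.
Qed.

End Separation.

(** * Consequences of inseparability *)

Section Inseparable.
Context (K : fieldType) (charK : [pchar K]%R =i pred0).
Context (m n : nat) (G : graph m n) (A : {set 'I_m}).
Hypothesis bipA : forall i j, adj G i j -> (i \in A) != (j \in A).
Implicit Types (u v w : 'rV[int]_n).

Local Notation inc := (incidence G).
Local Notation L := (relation_lattice G).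

(** The signed sum of the edges of a walk telescopes, since the signs of its vertices alternate. *)
Lemma walk_vec (r : rel 'I_m) (N : pred 'I_n) a b :
    (forall i j, r i j -> adj G i j) ->
    (forall i j k, r i j -> G k = [set i; j]%SET -> ~~ N k) ->
    connect r a b ->
  exists w, w *m inc = side A a *: delta_mx 0 a - side A b *: delta_mx 0 b
    /\ forall k, N k -> w 0 k = 0.
Proof.
move=> rG rN /connectP[p + ->]; elim: p a => [|i p IHp] a /=.
  by exists 0; split=> [|k _]; rewrite ?mul0mx ?subrr ?mxE.
case/andP=> ai /IHp[w [wE wN]]; have aiG := rG _ _ ai.
exists (side A a *: edge_vec G a i + w); split=> [|k Nk].
  rewrite mulmxDl -scalemxAl edge_vec_incidence // wE (side_adj bipA aiG).
  by rewrite scalerDr scaleNr addrA addrK.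
rewrite !mxE wN // addr0; case: eqP => [Gk|]; last by rewrite mulr0.
by have := rN _ _ _ ai Gk; rewrite Nk.
Qed.

Lemma relation_degree_avoiding e z v :
    z \in G e -> (forall k, z \in G k -> v 0 k = 0) ->
  ~ H G (relation_degree G v - h G e).
Proof.
move=> ze v0 /H_ge0/(_ z); rewrite !mxE hE ze summxE big1 ?sub0r // => k _.
by rewrite -scaler_int mxE hE; case: (boolP (z \in G k)) => [/v0->|]; rewrite ?mulr0 ?mul0r.
Qed.

(** The vector [u] follows [v] along the edges at y and then walks inside G - x - y to the root of
    the component reached. Its balance at a root is, up to sign, the flux of [v] through that
    component, which is 0 by inseparability. *)
Lemma inseparable_eq0 (V : zmodType) (c : 'rV[int]_n -> V) e :
    ~ separable_at K L e ->
    (forall u v, L u -> L v -> c (u + v) = c u + c v) ->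
    (forall v, L v -> ~ H G (relation_degree G v - h G e) -> c v = 0) ->
  forall v, L v -> v 0 e = 0 -> c v = 0.
Proof.
move=> insep cD c0 v Lv ve.
have /eqP/cards2P[x [y [xy Ge]]] := card_edge G e.
pose r i j := [&& adj G i j, i \notin G e & j \notin G e].
have r_sym : connect_sym r.
  by apply: sym_connect_sym => i j; rewrite /r adj_sym andbCA andbC -andbA andbC.
pose rt a := fingraph.root r a.
have xe : x \in G e by rewrite Ge !inE eqxx.
have ye : y \in G e by rewrite Ge !inE eqxx orbT.
have yeE k : y \in G k -> x \in G k -> k = e.
  move=> yk xk; apply: (@edge_inj _ _ G); apply/eqP; rewrite eq_sym eqEcard.
  by rewrite {1}Ge finset.subUset !finset.sub1set xk yk !card_edge.
have ex_w a : exists w,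
    w *m inc = side A a *: delta_mx 0 a - side A (rt a) *: delta_mx 0 (rt a)
    /\ forall k, (x \in G k) || (y \in G k) -> w 0 k = 0.
  apply: (walk_vec (r := r)) => [i j /and3P[]//|i j k|].
    case/and3P=> _ + + ->; rewrite Ge !inE !negb_or => /andP[ix iy] /andP[jx jy].
    by rewrite !(eq_sym x) !(eq_sym y) ix iy jx jy.
  exact: connect_root.
have {ex_w} [w wP] := boolp.choice ex_w.
(* [o k] is the other end of an edge [k] at y, and has no meaning for other edges. *)
have ex_o k : exists a, y \in G k -> G k = [set y; a]%SET.
  have [/edge_endpoint[a _ ->]|_] := boolP (y \in G k); first by exists a.
  by exists y.
have {ex_o} [o oP] := boolp.choice ex_o.
pose Py := [pred k | (y \in G k) && (k != e)].
pose u := \sum_(k | Py k) v 0 k *: (delta_mx 0 k - side A (o k) *: w (o k)).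
have adj_o k : y \in G k -> adj G y (o k) by move/oP=> Gk; apply/adjP; exists k.
have oNe k : Py k -> o k \notin G e.
  case/andP=> yk ke; have := adj_neq (adj_o k yk); rewrite Ge !inE negb_or eq_sym => ->.
  rewrite andbT; apply: contra ke => /eqP ox; apply/eqP/yeE => //.
  by rewrite (oP k yk) -ox !inE eqxx orbT.
have sum_y : \sum_(k | Py k) v 0 k = 0.
  have /relation_latticeP/rowP/(_ y) := Lv; rewrite !mxE (bigD1 e) //= ve mul0r add0r => E.
  rewrite -[RHS]E big_mkcond [RHS]big_mkcond; apply: eq_bigr => k _ /=; rewrite mxE andbC.
  by case: (k != e); case: (y \in G k); rewrite ?mulr1 ?mulr0.
have sum_rt z : \sum_(k | Py k && (rt (o k) == z)) v 0 k = 0.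
  (* The component with root z, and the empty set when z is no such root. *)
  pose Q := [set i | (i \notin G e) && (rt i == z)]%SET.
  have xNQ : x \notin Q by rewrite !inE xe.
  have yNQ : y \notin Q by rewrite !inE Ge !inE eqxx orbT.
  have closedQ i j : adj G i j -> i \in Q -> [|| j \in Q, j == x | j == y].
    move=> ij; rewrite !inE => /andP[ie /eqP <-].
    have [je|je] := boolP (j \in G e); first by move: je; rewrite Ge !inE => ->; rewrite orbT.
    by rewrite /rt (root_connect r_sym) (connect1 (_ : r j i)) // /r adj_sym ij je.
  have : flux G y Q v = 0.
    apply: contrapT => /eqP fv; apply: insep.
    exact: (flux_separable charK bipA Ge xNQ yNQ closedQ Lv ve fv).
  rewrite fluxE => /eqP; rewrite oppr_eq0 => /eqP E; rewrite -[RHS]E; apply: eq_bigl => k /=.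
  rewrite -andbA andbC; have [yk|_] := boolP (y \in G k); last by rewrite !andbF.
  rewrite !andbT; apply/andP/existsP => [[ke rk]|[i]].
    have Pyk : Py k by rewrite /= yk.
    by exists (o k); rewrite inE (oNe k Pyk) rk (oP k yk) !inE eqxx orbT.
  rewrite !inE (oP k yk) !inE => /andP[/andP[ie ri]].
  move/orP=> [/eqP iy|/eqP io]; first by move: ie; rewrite iy ye.
  split; last by rewrite -io.
  by apply: contraNneq ie => <-; rewrite (oP k yk) io !inE eqxx orbT.
have Lu : L u.
  apply/relation_latticeP; rewrite mulmx_suml.
  transitivity (\sum_(k | Py k) v 0 k *: delta_mx 0 y
     - side A y *: \sum_(k | Py k) v 0 k *: (side A (rt (o k)) *: delta_mx 0 (rt (o k)))
     : 'rV[int]_m).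
    rewrite scaler_sumr -sumrB; apply: eq_bigr => k /andP[yk _].
    rewrite -scalemxAl mulmxBl -scalemxAl (proj1 (wP _)) delta_incidence.
    rewrite (h_set2 (oP k yk)) [side A (o k) *: (_ - _)]scalerBr.
    rewrite [side A (o k) *: (side A (o k) *: _)]scalerA side_sqr scale1r opprB.
    rewrite addrA addrAC addrK (side_adj bipA (adj_o k yk)) scaleNr scalerBr.
    by congr (_ - _); rewrite !scalerA; congr (_ *: _); ring.
  rewrite -scaler_suml sum_y scale0r sub0r.
  rewrite (_ : \sum_(k | _) _ = 0) ?scaler0 ?oppr0 //.
  apply/rowP => z; rewrite summxE [RHS]mxE.
  transitivity (side A z * \sum_(k | Py k && (rt (o k) == z)) v 0 k); last first.
    by rewrite sum_rt mulr0.
  rewrite mulr_sumr [RHS]big_mkcondr; apply: eq_bigr => k _; rewrite !mxE /=.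
  have [<-|_] := eqVneq (rt (o k)) z; first by rewrite mulr1 mulrC.
  by rewrite !mulr0.
have ux k : x \in G k -> u 0 k = 0.
  move=> xk; rewrite summxE big1 // => l /andP[yl le]; rewrite !mxE /=.
  rewrite (proj2 (wP _)) ?xk // mulr0 subr0.
  have [kl|_] := eqVneq k l; last by rewrite mulr0.
  by case/eqP: le; apply: yeE; rewrite // -kl.
have uy k : y \in G k -> (v - u) 0 k = 0.
  move=> yk; rewrite !mxE summxE; have [->|ke] := eqVneq k e.
    by rewrite -summxE ux ?ve ?subrr // xe.
  rewrite (bigD1 k) ?inE ?yk //= big1 => [|l /andP[_ lk]]; rewrite !mxE /=.
    by rewrite (proj2 (wP _)) ?yk ?orbT // eqxx mulr0 subr0 mulr1 subrr.
  by rewrite (proj2 (wP _)) ?yk ?orbT // eq_sym (negPf lk) mulr0 subr0 mulr0.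
have Lvu : L (v - u) by apply: relation_latticeB.
rewrite -(subrK u v) cD // !c0 ?addr0 //.
  by apply: (relation_degree_avoiding (z := x)).
by apply: (relation_degree_avoiding (z := y)); rewrite // Ge !inE eqxx orbT.
Qed.

(** For a fixed w with w_e != 0, the combination w_e v - v_e w is killed by [c]; characteristic 0
    permits division by w_e. *)
Lemma inseparable_coord (c : 'rV[int]_n -> K) e :
    ~ separable_at K L e ->
    (forall u v, L u -> L v -> c (u + v) = c u + c v) ->
    (forall v, L v -> ~ H G (relation_degree G v - h G e) -> c v = 0) ->
  exists a : K, forall v, L v -> c v = a * (v 0 e)%:~R.
Proof.
move=> insep cD c0; have c_eq0 := inseparable_eq0 insep cD c0.
have cZ := relation_lattice_additiveZ cD.
have [[w [Lw we]]|no] := pselect (exists w, L w /\ w 0 e != 0); last first.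
  exists 0 => v Lv; rewrite mul0r; apply: c_eq0 => //.
  by apply: contrapT => /eqP ve; apply: no; exists v.
have we0 : (w 0 e)%:~R != 0 :> K by rewrite (intr_char0_eq0 charK).
exists (c w / (w 0 e)%:~R) => v Lv.
have : c (w 0 e *: v + (- v 0 e) *: w) = 0.
  apply: c_eq0; last by rewrite !mxE mulNr mulrC addrN.
  by apply: relation_latticeD; apply: relation_latticeZ.
rewrite cD ?cZ //; [|exact: relation_latticeZ..].
move/eqP; rewrite rmorphN mulNr subr_eq0 => /eqP E; apply: (mulfI we0).
by rewrite E; field.
Qed.

End Inseparable.

(** * The edge ring and its cotangent functor *)

Section RowForm.
Context (R : comNzRingType) (n : nat) (r : 'I_n -> R).

Definition row_form (w : 'rV[R]_n) : R^o := \sum_i w 0 i * r i.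

Lemma row_form_is_linear : linear row_form.
Proof.
move=> a u v; rewrite /row_form scaler_sumr -big_split; apply: eq_bigr => i _.
by rewrite !mxE mulrDl /= -mulrA.
Qed.

HB.instance Definition _ :=
  GRing.isLinear.Build R 'rV[R]_n R^o *:%R row_form row_form_is_linear.

End RowForm.

Section EdgeRing.
Context (m n : nat) (G : graph m n) (K : fieldType).
Local Notation ER := (edge_ring G K).
Local Notation L := (relation_lattice G).
Implicit Types (a b : 'rV[int]_m) (p q : ER) (v w : 'rV[int]_n).

Lemma er_val0 : val (0 : ER) = 0 :> {mpoly K[m]}.
Proof. by []. Qed.

Lemma er_valD p q : val (p + q) = val p + val q :> {mpoly K[m]}.
Proof. by []. Qed.

Lemma er_valB p q : val (p - q) = val p - val q :> {mpoly K[m]}.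
Proof. by []. Qed.

Lemma er_valM p q : val (p * q) = val p * val q :> {mpoly K[m]}.
Proof. by []. Qed.

Lemma er_val_eq0 p : (val p == 0 :> {mpoly K[m]}) = (p == 0).
Proof. by rewrite -er_val0 (inj_eq val_inj). Qed.

(** Only used for [a] in H, where [val_emon] rules out the default 0. *)
Definition emon (l : K) a : ER := insubd (0 : ER) (l *: tpow K a).

Lemma mon_degree_inj : injective (@mon_degree m).
Proof.
move=> s t /rowP st; apply/mnmP => i; have := st i; rewrite !mxE => -[].
by [].
Qed.

Definition mon_of a : 'X_{1..m} := [multinom absz (a ord0 i) | i < m].

Lemma mon_ofK a : (forall i, 0 <= a 0 i) -> mon_degree (mon_of a) = a.
Proof. by move=> a0; apply/rowP => i; rewrite mxE mnmE gez0_abs. Qed.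

Lemma mon_of_H a : H G a -> mon_degree (mon_of a) = a.
Proof. by move/H_ge0/mon_ofK. Qed.

Lemma tpowD a b : (forall i, 0 <= a 0 i) -> (forall i, 0 <= b 0 i) ->
  tpow K (a + b) = tpow K a * tpow K b.
Proof.
move=> a0 b0; rewrite -mpolyXD -[LHS]/('X_[mon_of (a + b)]); congr 'X_[_]; apply: mon_degree_inj.
rewrite mon_degreeD -/(mon_of a) -/(mon_of b) !mon_ofK // => i.
by rewrite mxE addr_ge0.
Qed.

Lemma val_emon l a : H G a -> val (emon l a) = l *: tpow K a.
Proof.
move=> Ha; rewrite insubdK //; apply/edge_ring_predP => u.
by move/msuppZ_le; rewrite msuppX inE => /eqP ->; rewrite -/(mon_of a) mon_of_H.
Qed.

Lemma mon_homog_emon l a : H G a -> mon_homog a (emon l a).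
Proof.
move=> Ha u; rewrite val_emon // => /msuppZ_le; rewrite msuppX inE => /eqP ->.
exact: mon_of_H.
Qed.

Lemma mon_homog0 a : mon_homog a (0 : ER).
Proof. by move=> u; rewrite er_val0 msupp0. Qed.

Lemma mon_homog_sum (I : finType) a (F : I -> ER) :
  (forall i, mon_homog a (F i)) -> mon_homog a (\sum_i F i).
Proof.
move=> Fa; elim/big_rec: _ => [|i p _ IHp]; first exact: mon_homog0.
by move=> u; rewrite er_valD => /msuppD_le; rewrite mem_cat => /orP[/Fa|/IHp].
Qed.

Lemma mon_homogM a b p q : mon_homog a p -> mon_homog b q -> mon_homog (a + b) (p * q).
Proof.
move=> pa qb u; rewrite er_valM => /msuppM_le/allpairsP[[s t] /= [/pa <- /qb <- ->]].
exact: mon_degreeD.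
Qed.

Definition ev p : K := (val p).@[fun=> 1].

Lemma evD p q : ev (p + q) = ev p + ev q.
Proof. by rewrite /ev er_valD mevalD. Qed.

Lemma evB p q : ev (p - q) = ev p - ev q.
Proof. by rewrite /ev er_valB mevalB. Qed.

Lemma evM p q : ev (p * q) = ev p * ev q.
Proof. by rewrite /ev er_valM mevalM. Qed.

Lemma ev0 : ev 0 = 0.
Proof. by rewrite /ev er_val0 meval0. Qed.

Lemma ev_sum (I : finType) (F : I -> ER) : ev (\sum_i F i) = \sum_i ev (F i).
Proof. exact: (big_morph ev evD ev0). Qed.

Lemma meval_tpow a : (tpow K a).@[fun=> 1] = 1.
Proof. by rewrite mevalX big1 // => i _; rewrite expr1n. Qed.

Lemma ev_emon l a : H G a -> ev (emon l a) = l.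
Proof. by move=> Ha; rewrite /ev val_emon // mevalZ meval_tpow mulr1. Qed.

(** A homogeneous element is a scalar times one monomial, and evaluation at (1, .., 1) reads off the
    scalar. *)
Lemma ev_homog_eq0 a p : mon_homog a p -> ev p = 0 -> p = 0.
Proof.
move=> pa p0; apply: contrapT => /eqP pn0.
have {}pn0 : val p != 0 by rewrite er_val_eq0.
have lp := mlead_supp pn0.
have def_p : msupp (val p) = [:: mlead (val p)].
  apply: perm_small_eq => //; apply: uniq_perm; rewrite ?msupp_uniq // => u.
  rewrite inE.
  apply/idP/eqP => [up|->//]; apply: mon_degree_inj.
  by rewrite (pa _ up) (pa _ lp).
have := p0; rewrite /ev [val p]mpolyE def_p big_seq1 mevalZ mevalX.
rewrite big1 ?mulr1 => [/eqP|i _]; last by rewrite expr1n.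
by rewrite mcoeff_eq0 lp.
Qed.

Lemma homog_neq0_H a p : mon_homog a p -> p != 0 -> H G a.
Proof.
move=> pa pn0.
have {}pn0 : val p != 0 by rewrite er_val_eq0.
have lp := mlead_supp pn0; rewrite -(pa _ lp).
by case: p pn0 lp {pa} => q /= /edge_ring_predP + _ lp; apply.
Qed.

Lemma H_sum (P : pred 'I_n) (c : 'I_n -> nat) : H G (\sum_(k | P k) h G k *+ c k).
Proof.
exists (fun k => if P k then c k else 0%N); rewrite big_mkcond.
by apply: eq_bigr => k _; case: (P k); rewrite ?mulr0n.
Qed.

Lemma H_h k : H G (h G k).
Proof.
by rewrite -[h G k](big_pred1_eq +%R k (fun k => h G k *+ 1)); apply: H_sum.
Qed.

Lemma relation_degree_pos v :
  relation_degree G v = \sum_(k | 0 <= v 0 k) h G k *+ absz (v 0 k).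
Proof. by apply: eq_bigr => k vk; rewrite pmulrn gez0_abs. Qed.

Lemma relation_degree_neg v : L v ->
  relation_degree G v = \sum_(k | v 0 k <= 0) h G k *+ absz (v 0 k).
Proof.
rewrite /relation_lattice /= (bigID (fun k => 0 <= v 0 k)) /=.
move/eqP; rewrite addr_eq0 => /eqP E; rewrite /relation_degree E -sumrN.
rewrite big_mkcond [RHS]big_mkcond; apply: eq_bigr => k _; rewrite -ltNge.
case: ltgtP => // [vk|->]; last by rewrite mulr0n.
by rewrite pmulrn ltz0_abs // mulrNz.
Qed.

Lemma relation_degree_H v : H G (relation_degree G v).
Proof. by rewrite relation_degree_pos; apply: H_sum. Qed.

(** h(v) is the degree of the positive as well as of the negative part of [v]; the common sign of
    v_e and v_f selects the part containing both edges. *)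
Lemma relation_degreeB2 v e f :
    L v -> e != f -> v 0 e = v 0 f -> v 0 e != 0 ->
  H G (relation_degree G v - h G e - h G f).
Proof.
move=> Lv ef vef ve0.
have sub (P : pred 'I_n) (c : 'I_n -> nat) : P e -> P f -> (0 < c e)%N -> (0 < c f)%N ->
    H G (\sum_(k | P k) h G k *+ c k - h G e - h G f).
  move=> Pe Pf ce cf.
  rewrite (bigD1 e) //= (bigD1 f) /=; last by rewrite Pf eq_sym.
  rewrite -(prednK ce) -(prednK cf) !mulrS.
  set S := \sum_(_ | _) _; have -> : forall x y z t : 'rV[int]_m,
    x + y + (z + t + S) - x - z = y + t + S
    by move=> x y z t; apply/rowP => i; rewrite !mxE; ring.
  by apply: HD; [apply: HD|]; rewrite /S; try exact: H_sum;
    rewrite -(big_pred1_eq +%R _ (fun k => h G k *+ _)); apply: H_sum.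
have [ve|ve] := leP 0 (v 0 e).
  by rewrite relation_degree_pos; apply: sub; rewrite -?vef // absz_gt0.
by rewrite relation_degree_neg //; apply: sub; rewrite -?vef ?(ltW ve) // absz_gt0.
Qed.

Lemma free_homog_df v : L v -> free_homog (relation_degree G v) (df G K v).
Proof.
move=> Lv i u; rewrite val_df //; have [->|vi0] := eqVneq (v 0 i) 0.
  by rewrite scale0r msupp0.
move/msuppZ_le; rewrite msuppX inE => /eqP ->; apply: mon_of_H.
exact: relation_degreeBh.
Qed.

Definition df_elt v : df_module G K := insubd (0 : df_module G K) (df G K v).

Lemma val_df_elt v : L v -> val (df_elt v) = df G K v.
Proof.
move=> Lv; rewrite insubdK //; apply/asboolP => M [_]; apply.
by exists v.
Qed.

(* After multiplication by t^(h_i) both sides become multiples of the same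
   monomial, which avoids a case split on the vanishing of coefficients. *)
Lemma df_cocycle u v : L u -> L v -> L (u + v) ->
  (emon 1 (relation_degree G u) * emon 1 (relation_degree G v)) *: df_elt (u + v)
  = emon 1 (relation_degree G (u + v)) *:
     (emon 1 (relation_degree G v) *: df_elt u + emon 1 (relation_degree G u) *: df_elt v).
Proof.
move=> Lu Lv Luv; apply: val_inj; rewrite !(linearZ, linearD) /= !val_df_elt //.
have key w i : L w -> tpow K (h G i) * val (df G K w 0 i)
    = (w 0 i)%:~R *: tpow K (relation_degree G w).
  move=> Lw; rewrite val_df //; have [->|wi0] := eqVneq (w 0 i) 0.
    by rewrite !scale0r mulr0.
  rewrite -scalerAr -tpowD; [|exact/H_ge0/H_h|exact/H_ge0/relation_degreeBh].
  by rewrite addrC subrK.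
apply/rowP => i; apply: val_inj.
have t0 : tpow K (h G i) != 0 by rewrite -msupp_eq0 msuppX.
apply: (mulfI t0).
have scE (s : ER) (w : 'rV[ER]_n) : (s *: w) 0 i = s * w 0 i by rewrite mxE.
have adE (w1 w2 : 'rV[ER]_n) : (w1 + w2) 0 i = w1 0 i + w2 0 i by rewrite mxE.
rewrite !(scE, adE) !(er_valM, er_valD).
have Hd w := relation_degree_H w.
rewrite !val_emon // !scale1r.
have ku := key _ i Lu; have kv := key _ i Lv; have kuv := key _ i Luv.
rewrite mulrCA kuv; rewrite [RHS]mulrCA mulrDr [_ * (_ * val (df _ _ u _ _))]mulrCA ku.
rewrite [_ * (_ * val (df _ _ v _ _))]mulrCA kv mxE rmorphD scalerDl.
by rewrite -!scalerAr -!mul_mpolyC; ring.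
Qed.

End EdgeRing.

(** * Functionals on U and their coefficients *)

Section T1.
Context (m n : nat) (G : graph m n) (K : fieldType).
Local Notation ER := (edge_ring G K).
Local Notation L := (relation_lattice G).
Implicit Types (a b : 'rV[int]_m) (p q : ER) (v w : 'rV[int]_n).

Lemma df_module_ext (phi psi : {linear df_module G K -> ER^o}) :
  (forall v, L v -> phi (df_elt G K v) = psi (df_elt G K v)) -> forall u, phi u = psi u.
Proof.
move=> eq_gen u.
pose M : set 'rV[ER]_n := [set w | exists2 u, val u = w & phi u = psi u]%classic.
suff [u' /val_inj -> //] : M (val u).
case: u => w /= /asboolP; apply; split.
  split=> [|c _ _ [u1 <- e1] [u2 <- e2]].
    by exists 0; rewrite ?linear0 ?raddf0.
  by exists (c *: u1 + u2); rewrite !linearP ?e1 ?e2.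
by move=> _ [v Lv <-]; exists (df_elt G K v); rewrite ?val_df_elt ?eq_gen.
Qed.

(* phi(df_v) is homogeneous of degree a + h(v), hence a multiple of a single
   monomial; this is its coefficient. *)
Definition coeff_on (phi : df_module G K -> ER) v : K := ev (phi (df_elt G K v)).

Section Dual.
Context (phi : {linear df_module G K -> ER^o}) (a : 'rV[int]_m).
Hypothesis phi_homog : df_module_dual_homog a phi.

(** Apply [phi] to [df_cocycle]; at t = (1, .., 1) every monomial becomes 1. *)
Lemma coeff_onD v w : L v -> L w -> coeff_on phi (v + w) = coeff_on phi v + coeff_on phi w.
Proof.
move=> Lv Lw; have := congr1 (fun u => ev (phi u)) (df_cocycle K Lv Lw (relation_latticeD Lv Lw)).
rewrite !(linearZ, linearD) /= -![_ *: (_ : ER^o)]/(_ * _ : ER) !(evM, evD).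
by rewrite !ev_emon ?mul1r //; apply: relation_degree_H.
Qed.

Lemma dual_df_homog v : L v -> mon_homog (a + relation_degree G v) (phi (df_elt G K v)).
Proof. by move=> Lv; apply: phi_homog; rewrite val_df_elt //; apply: free_homog_df. Qed.

Lemma coeff_on_H v : L v -> coeff_on phi v != 0 -> H G (a + relation_degree G v).
Proof.
move=> Lv cv; apply: homog_neq0_H (dual_df_homog Lv) _.
by apply: contraNneq cv => phi0; rewrite /coeff_on phi0 ev0.
Qed.

(** [r i] is the image of dx_i. Both functionals are homogeneous, so they agree on df_v as soon as
    they do at t = (1, .., 1). *)
Lemma dual_extends (r : 'I_n -> ER) :
    (forall i, mon_homog (a + h G i) (r i)) ->
    (forall v, L v -> coeff_on phi v = \sum_i (v 0 i)%:~R * ev (r i)) ->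
  exists psi : {linear 'rV[ER]_n -> ER^o},
    free_dual_homog a psi /\ forall u : df_module G K, phi u = psi (val u).
Proof.
move=> rh cr; exists (row_form r).
have rfh : free_dual_homog a (row_form r).
  move=> b w wb; apply: mon_homog_sum => i.
  have -> : a + b = b - h G i + (a + h G i) by rewrite addrACA addNr addr0 addrC.
  exact: mon_homogM (wb i) (rh i).
split=> //; pose psi (u : df_module G K) : ER^o := row_form r (val u).
have psi_lin : linear psi.
  by move=> c u v; rewrite /psi /= !linearP.
pose Psi : {linear df_module G K -> ER^o} := HB.pack psi (GRing.isLinear.Build _ _ _ _ psi psi_lin).
apply: (@df_module_ext phi Psi) => v Lv.
apply/eqP; rewrite -subr_eq0; apply/eqP.
apply: (@ev_homog_eq0 _ _ _ _ (a + relation_degree G v)).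
  move=> s; rewrite er_valB => /msuppB_le; rewrite mem_cat => /orP[].
    exact: dual_df_homog.
  by rewrite /Psi /= /psi /= val_df_elt //; apply: rfh; apply: free_homog_df.
rewrite evB -/(coeff_on phi v) cr // /Psi /= /psi /= val_df_elt // ev_sum.
apply/eqP; rewrite subr_eq0; apply/eqP; apply: eq_bigr => i _; rewrite evM; congr (_ * _).
by rewrite /ev val_df // mevalZ meval_tpow mulr1.
Qed.

End Dual.
End T1.

(** * A nonzero component of T^1 *)

Section NonzeroT1.
Context (m n : nat) (G : graph m n) (K : fieldType).
Context (charK : [pchar K]%R =i pred0).
Local Notation ER := (edge_ring G K).
Local Notation L := (relation_lattice G).
Implicit Types (v w : 'rV[int]_n).

Lemma sum_h k : \sum_i h G k 0 i = 2.
Proof.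
under eq_bigr => i _ do rewrite hE.
by rewrite -natr_sum -big_mkcond sum1_card card_edge.
Qed.

(* The functional u |-> u_e / t^(h_f) of U has degree -(h_e + h_f), while a
   functional of that degree on the free module is zero. *)
Lemma T1_component_neq0 e f w :
    e != f -> (forall v, L v -> v 0 e = v 0 f) -> L w -> w 0 e != 0 ->
  ~ T1_component_zero G K (- (h G e + h G f)).
Proof.
move=> ef vef Lw we T10.
pose t : ER := emon G 1 (h G f).
have t_val : val t = tpow K (h G f) by rewrite val_emon ?scale1r //; apply: H_h.
have t_neq0 : val t != 0 by rewrite t_val -msupp_eq0 msuppX.
have t_inj p q : p * t = q * t -> p = q.
  move/(congr1 val); rewrite !er_valM => /(mulIf t_neq0); exact: val_inj.
have ex_div (u : df_module G K) : exists r : ER, val u 0 e = r * t.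
  pose M : set 'rV[ER]_n := [set w | exists r : ER, w 0 e = r * t]%classic.
  suff : M (val u) by [].
  case: u => u /= /asboolP; apply; split.
    split=> [|c u1 u2 [r1 e1] [r2 e2]]; first by exists 0; rewrite mul0r mxE.
    by exists (c * r1 + r2); rewrite !mxE e1 e2 mulrDl mulrA.
  move=> _ [v Lv <-]; have [ve|ve] := eqVneq (v 0 e) 0.
    by exists 0; apply: val_inj; rewrite mul0r val_df // ve scale0r.
  have Hv := relation_degreeB2 Lv ef (vef v Lv) ve.
  exists (emon G (v 0 e)%:~R (relation_degree G v - h G e - h G f)).
  apply: val_inj; rewrite er_valM t_val val_df // val_emon // -scalerAl.
  by rewrite -tpowD ?subrK //; [apply: H_ge0 Hv | apply: H_ge0 (H_h G f)].
(* The quotient by t is unique in a domain, which makes it linear in [u]. *)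
have [phi phiE] := boolp.choice ex_div.
have phi_lin : linear (phi : df_module G K -> ER^o).
  move=> c u v; apply: t_inj; rewrite -phiE linearP !mxE !phiE mulrDl.
  by rewrite -[c *: _]/(c * phi u) mulrA.
pose Phi : {linear df_module G K -> ER^o} := HB.pack phi (GRing.isLinear.Build _ _ _ _ phi phi_lin).
have [|psi [psi_homog psiE]] := T10 Phi.
  move=> b u ub s su.
  have : (mon_of (h G f) + s)%MM \in msupp (val (val u 0 e)).
    rewrite phiE er_valM t_val (perm_mem (msuppMX _ _)).
    exact: map_f.
  move/ub; rewrite mon_degreeD (mon_of_H (H_h G f)).
  by move=> E; rewrite opprD addrC addrA -E addrC addKr.
(* The degree h_i - h_e - h_f has coordinate sum 2 - 4 = -2, so it is not in H. *)
have psi0 i : psi (delta_mx 0 i) = 0.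
  have : mon_homog (- (h G e + h G f) + h G i) (psi (delta_mx 0 i)).
    apply: psi_homog => j; rewrite mxE eqxx; have [->|_] := eqVneq j i; last exact: mon_homog0.
    by move=> s; rewrite msupp1 inE subrr => /eqP ->; apply/rowP => z; rewrite !mxE mnm0E.
  move=> hom; apply: contrapT => /eqP /(homog_neq0_H hom)/H_ge0 ge0.
  have : 0 <= \sum_j (- (h G e + h G f) + h G i) 0 j by apply: sumr_ge0 => j _; apply: ge0.
  have entry j : (- (h G e + h G f) + h G i) 0 j = h G i 0 j - (h G e 0 j + h G f 0 j).
    by move: (h G e) (h G f) (h G i) => x y z; rewrite !mxE addrC.
  under eq_bigr => j _ do rewrite entry.
  by rewrite sumrB big_split /= !sum_h.
have : val (df G K w 0 e) = 0.
  rewrite -val_df_elt // phiE -[phi _]/(Phi (df_elt G K w)) psiE.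
  rewrite (row_sum_delta (val (df_elt G K w))) linear_sum big1 ?mul0r // => i _.
  by rewrite linearZ /= psi0 scaler0.
rewrite val_df // => /eqP; rewrite scaler_eq0 (intr_char0_eq0 charK) (negPf we) /=.
by rewrite -msupp_eq0 msuppX.
Qed.

End NonzeroT1.

(** * Parity in a cycle and signs of its vector *)

Section ParityOfEdges.
Context (m n : nat) (G : graph m n) (A : {set 'I_m}).
Hypothesis bipA : forall i j, adj G i j -> (i \in A) != (j \in A).
Local Notation L := (relation_lattice G).
Implicit Types (c : seq 'I_m) (v w : 'rV[int]_n).

(** Positive entries sit on the edges that leave a vertex of [A], and at most one such edge contains
    [z]. This bound later excludes e = f. *)
Lemma relation_degree_cycle c z : is_cycle G c -> z \in A ->
  relation_degree G (cycle_vec G A c) 0 z <= 1.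
Proof.
move=> Cc zA; rewrite summxE.
apply: (@le_trans _ _ (\sum_k (G k == [set z; next c z]%SET)%:R)).
  rewrite big_mkcond; apply: ler_sum => k _; case: ifP => vk; last by rewrite ler0n.
  rewrite -scaler_int mxE hE; have [zk|] := boolP (z \in G k); last by rewrite mulr0 ler0n.
  have [/eqP->|] := boolP (cycle_vec G A c 0 k == 0); first by rewrite mul0r ler0n.
  rewrite cycle_vec_eq0 // negbK => /mapP[x xc Gk].
  move: vk; rewrite (cycle_vecE A Cc xc Gk) /side; case: ifP => // xA _.
  have xnx := bipA (cycle_edges_adj Cc xc).
  suff -> : z = x by rewrite Gk eqxx.
  move: zk; rewrite Gk !inE => /orP[/eqP//|/eqP E].
  by move: xnx; rewrite xA -E zA.
have [[k Gk]|no] := pselect (exists k, G k = [set z; next c z]%SET).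
  rewrite (bigD1 k) //= Gk eqxx big1 ?addr0 // => l lk.
  by rewrite -Gk (inj_eq (@edge_inj _ _ G)) (negPf lk).
by rewrite big1 // => k _; case: eqP => // Gk; case: no; exists k.
Qed.

Lemma same_parityP c e f : is_cycle G c ->
  (same_parity c (G e) (G f) <->
   [/\ e != f, cycle_vec G A c 0 e != 0 & cycle_vec G A c 0 e = cycle_vec G A c 0 f]).
Proof.
move=> Cc; have [s s0 par] := cycle_vec_parity bipA Cc.
split=> [[ef ec fc pef]|[ef ve vef]].
  split; first by apply: contraNneq ef => ->.
    by rewrite cycle_vec_eq0 // negbK.
  by rewrite !par // pef.
have ec : G e \in cycle_edges c by rewrite -[_ \in _]negbK -(@cycle_vec_eq0 _ _ _ A).
have fc : G f \in cycle_edges c by rewrite -[_ \in _]negbK -(@cycle_vec_eq0 _ _ _ A) -?vef.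
split=> //; first by rewrite (inj_eq (@edge_inj _ _ G)).
move: vef; rewrite !par // => /(mulIf s0).
by case: odd; case: odd.
Qed.

End ParityOfEdges.

(** * Semi-rigidity *)

Section SemiRigidity.
Context (m n : nat) (G : graph m n) (K : fieldType) (A : {set 'I_m}).
Context (charK : [pchar K]%R =i pred0).
Hypothesis bipA : forall i j, adj G i j -> (i \in A) != (j \in A).
Local Notation L := (relation_lattice G).
Implicit Types (v w : 'rV[int]_n).

Lemma exists_same_parity_cycle (e f : 'I_n) (c : 'rV[int]_n -> K) (x y : K) v0 :
    (forall v, L v -> c v = x * (v 0 e)%:~R) ->
    (forall v, L v -> c v = y * (v 0 f)%:~R) ->
    (forall v, L v -> c v != 0 -> H G (relation_degree G v - h G e - h G f)) ->
    L v0 -> c v0 != 0 ->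
  (exists2 C, induced_cycle G C & same_parity C (G e) (G f)) /\
  forall C, is_cycle G C -> (G e \in cycle_edges C) = (G f \in cycle_edges C).
Proof.
move=> ce cf cH Lv0 cv0.
have x0 : x != 0 by apply: contraNneq cv0 => x0; rewrite ce // x0 mul0r.
have y0 : y != 0 by apply: contraNneq cv0 => y0; rewrite cf // y0 mul0r.
have c_e v : L v -> (c v == 0) = (v 0 e == 0).
  by move=> Lv; rewrite ce // mulf_eq0 (negPf x0) (intr_char0_eq0 charK).
have c_f v : L v -> (c v == 0) = (v 0 f == 0).
  by move=> Lv; rewrite cf // mulf_eq0 (negPf y0) (intr_char0_eq0 charK).
split=> [|C CC]; last first.
  have LC := cycle_vec_lattice bipA CC.
  by apply: negb_inj; rewrite -!(cycle_vec_eq0 A) // -c_e // c_f.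
have ve0 : v0 0 e != 0 by rewrite -c_e.
have [C IC eC] := exists_induced_cycle_through bipA Lv0 ve0.
exists C => //; have [CC _] := IC; apply/(same_parityP bipA) => //.
set v := cycle_vec G A C; have Lv : L v := cycle_vec_lattice bipA CC.
have ve : v 0 e != 0 by rewrite cycle_vec_eq0 // negbK.
have vf : v 0 f != 0 by rewrite -c_f // c_e.
have Hv : H G (relation_degree G v - h G e - h G f) by apply: cH; rewrite ?c_e.
have ef : e != f.
  (* If e = f, an end of [e] in [A] has entry at most 1 in h(v) but entry 2 in h_e + h_f. *)
  apply/eqP => ef; have [z ze zA] : exists2 z, z \in G e & z \in A.
    have /eqP/cards2P[a [b] [_ Ge]] := card_edge G e.
    have ab : adj G a b by apply/adjP; exists e.
    have [aA|aN] := boolP (a \in A); first by exists a; rewrite // Ge !inE eqxx.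
    exists b; first by rewrite Ge !inE eqxx orbT.
    by move: (bipA ab); rewrite (negPf aN); case: (b \in A).
  have := H_ge0 Hv z; have := relation_degree_cycle bipA CC zA.
  rewrite -/v -ef; have hz : h G e 0 z = 1 by rewrite hE ze.
  move: (relation_degree G v) (h G e) hz => s t hz; rewrite !mxE hz.
  by move: (s 0 z); clear; lia.
split=> //; apply/eqP; apply: contraT => vef.
(* The expression h(v) = h_e + h_f + sum of d_k h_k, compared with the positive part of [v], gives a
   relation [w]. If v_f = -v_e, exactly one of them is positive, with value 1, so w_e + w_f >= 2 -
   1; but then x = -y, which forces w_e + w_f = 0. *)
have [d def_d] := Hv.
pose p k : int := if 0 <= v 0 k then v 0 k else 0.
pose w : 'rV[int]_n := \row_k ((k == e)%:R + (k == f)%:R + (d k)%:Z - p k).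
have Lw : L w.
  rewrite /relation_lattice /=.
  transitivity (h G e + h G f + \sum_k h G k *+ d k - relation_degree G v).
    have delta_sum l : h G l = \sum_k h G k *~ (k == l)%:R.
      by rewrite (bigD1 l) //= eqxx big1 ?addr0 // => k /negPf->.
    rewrite {1}(delta_sum e) {1}(delta_sum f) /relation_degree [X in _ - X]big_mkcond.
    rewrite -!big_split -sumrB; apply: eq_bigr => k _; rewrite mxE /p.
    by rewrite mulrzBr !mulrzDr; congr (_ - _); case: ifP.
  rewrite -def_d; move: (relation_degree G v) (h G e) (h G f) => s t u.
  by apply/rowP => i; rewrite !mxE; ring.
have we : w 0 e = 1 + (d e)%:Z - p e by rewrite mxE eqxx (negPf ef) addr0.
have wf : w 0 f = 1 + (d f)%:Z - p f by rewrite mxE eqxx eq_sym (negPf ef) add0r.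
have be := cycle_vec_bound A e CC; have bf := cycle_vec_bound A f CC.
have vfe : v 0 f = - v 0 e.
  by move: ve vf vef be bf; rewrite -/v; move: (v 0 e) (v 0 f); clear; lia.
have xy : x = - y.
  have : x * (v 0 e)%:~R = y * (v 0 f)%:~R by rewrite -ce // cf.
  rewrite vfe rmorphN mulrN -mulNr => /mulIf; apply.
  by rewrite (intr_char0_eq0 charK).
have : y * (w 0 e + w 0 f)%:~R = 0.
  by rewrite rmorphD mulrDr /= -cf // ce // xy mulNr addrN.
move/eqP; rewrite mulf_eq0 (negPf y0) (intr_char0_eq0 charK) we wf /p vfe /=.
move: ve be; rewrite -/v; move: (v 0 e) (d e) (d f) => s t u; clear.
by do ?case: ifP; lia.
Qed.

(** If c(v) != 0, then h(v) - b is in H, and adding b - h_e shows that h(v) - h_e is too. *)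
Lemma inseparable_vanish (e : 'I_n) (phi : {linear df_module G K -> (edge_ring G K)^o}) b :
    inseparable G K -> df_module_dual_homog (- b) phi -> H G (b - h G e) ->
  exists x : K, forall v, L v -> coeff_on phi v = x * (v 0 e)%:~R.
Proof.
move=> insep phib Hb; apply: (inseparable_coord charK bipA (insep e)).
  by move=> u v; apply: coeff_onD.
move=> v Lv NH; apply: contrapT => /eqP cv; apply: NH.
by have := HD (coeff_on_H phib Lv cv) Hb; rewrite addrACA addNr add0r.
Qed.

Lemma not_semi_rigid_edges : inseparable G K -> ~ semi_rigid G K ->
  exists e f : 'I_n, (exists2 C, induced_cycle G C & same_parity C (G e) (G f)) /\
  forall C, is_cycle G C -> (G e \in cycle_edges C) = (G f \in cycle_edges C).
Proof.
move=> insep nsr; apply: contrapT => no; apply: nsr => a _ [cc def_a] phi phi_homog.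
have a_b : a = - (\sum_k h G k *+ cc k) by rewrite -def_a opprK.
rewrite a_b in phi_homog * => {a_b def_a}.
have split1 (d : 'I_n -> nat) e : d e != 0%N ->
    \sum_k h G k *+ d k = h G e + \sum_k h G k *+ (d k - (k == e))%N.
  move=> de; rewrite (bigD1 e) //= [in RHS](bigD1 e) //= eqxx subn1 addrA -mulrS.
  rewrite prednK ?lt0n //; congr (_ + _).
  by apply: eq_bigr => k /negPf->; rewrite subn0.
have Hsum (d : 'I_n -> nat) : H G (\sum_k h G k *+ d k) by exists d.
(* The cases are: [b] involves no generator, one generator, or at least two. *)
have [[e ce]|cc0] := pselect (exists e, cc e != 0%N); last first.
  have {cc0} b0 : \sum_k h G k *+ cc k = 0.
    rewrite big1 // => k _; suff -> : cc k = 0%N by [].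
    by apply: contrapT => /eqP ck; apply: cc0; exists k.
  rewrite b0 oppr0 in phi_homog *.
  have [r [B [C [BC BM kerE]]]] := int_kernel_basis (incidence G).
  (* L is a direct summand of Z^n with retraction v |-> [v *m C *m B], so the additive map extends
     to Z^n; [lam i] is its value at the i-th basis vector. *)
  pose lam i := \sum_j (C i j)%:~R * coeff_on phi (row j B).
  apply: (dual_extends phi_homog (r := fun i => emon G (lam i) (h G i))) => [i|v Lv].
    by rewrite add0r; apply/mon_homog_emon/H_h.
  have LB j : L (row j B) by apply/relation_latticeP; rewrite -row_mul BM row0.
  have cD := @coeff_onD _ _ _ _ phi.
  have cZ := relation_lattice_additiveZ cD.
  have L0 := relation_lattice0 G.
  have c0 : coeff_on phi 0 = 0 by rewrite -[0](scale0r 0) cZ // mul0r.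
  have sumL (I : finType) (F : I -> 'rV_n) : (forall i, L (F i)) ->
      L (\sum_i F i) /\ coeff_on phi (\sum_i F i) = \sum_i coeff_on phi (F i).
    move=> LF; elim/big_rec2: _ => [//|i s u _ [Lu <-]].
    by rewrite cD //; split=> //; apply: relation_latticeD.
  have /relation_latticeP/kerE Ev := Lv.
  rewrite {1}Ev mulmx_sum_row.
  rewrite (proj2 (sumL _ _ _)) => [|j]; last exact: relation_latticeZ.
  transitivity (\sum_j \sum_i (v 0 i)%:~R * ((C i j)%:~R * coeff_on phi (row j B))).
    apply: eq_bigr => j _; rewrite cZ // mxE rmorph_sum mulr_suml.
    by apply: eq_bigr => i _; rewrite rmorphM mulrA.
  rewrite exchange_big; apply: eq_bigr => i _.
  by rewrite -mulr_sumr ev_emon //; apply: H_h.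
set b := \sum_k _ in phi_homog *.
pose d (k : 'I_n) := (cc k - (k == e))%N.
have def_b : b = h G e + \sum_k h G k *+ d k := split1 _ _ ce.
have Hbe : H G (b - h G e) by rewrite def_b addrC addKr; apply: Hsum.
have [x cx] := inseparable_vanish insep phi_homog Hbe.
(* Here [f] may still be [e], when h_e occurs twice in [b]. *)
have [[f df]|d0] := pselect (exists f, d f != 0%N); last first.
  have {}def_b : b = h G e.
    rewrite def_b big1 ?addr0 // => k _; suff -> : d k = 0%N by [].
    by apply: contrapT => /eqP dk; apply: d0; exists k.
  apply: (dual_extends phi_homog (r := fun i => if i == e then emon G x 0 else 0)).
    move=> i; case: eqP => [->|_]; last exact: mon_homog0.
    by rewrite def_b addNr; apply/mon_homog_emon/H0.
  move=> v Lv; rewrite cx // (bigD1 e) //= eqxx ev_emon; last exact: H0.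
  by rewrite big1 ?addr0 1?mulrC // => i /negPf->; rewrite ev0 mulr0.
have def_b2 := split1 _ _ df.
have Hbef : H G (b - h G e - h G f).
  by rewrite def_b [h G e + _]addrC addrK def_b2 addrC addKr; apply: Hsum.
have Hbf : H G (b - h G f).
  have := HD Hbef (H_h G e); rewrite addrAC subrK; exact.
have [y cy] := inseparable_vanish insep phi_homog Hbf.
have [[v0 [Lv0 cv0]]|c0] := pselect (exists v, L v /\ coeff_on phi v != 0).
  case: no; exists e, f; apply: exists_same_parity_cycle cx cy _ Lv0 cv0 => v Lv cv.
  have := HD (coeff_on_H phi_homog Lv cv) Hbef.
  by rewrite addrA addrACA addNr add0r.
apply: (dual_extends phi_homog (r := fun=> 0)) => [i|v Lv]; first exact: mon_homog0.
rewrite big1 => [|i _]; last by rewrite ev0 mulr0.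
by apply: contrapT => /eqP cv; apply: c0; exists v.
Qed.

(** The cycle [C] contains both edges, which settles the case exempted in the hypothesis, and its
    equal entries there make the factor of proportionality 1. *)
Lemma semi_rigid_no_edges e f C :
    induced_cycle G C -> same_parity C (G e) (G f) ->
    (forall C', induced_cycle G C' -> ~ cycle_edges C' =i cycle_edges C ->
      (G e \in cycle_edges C' <-> G f \in cycle_edges C')) ->
  ~ semi_rigid G K.
Proof.
move=> IC parC others sr; have [CC _] := IC.
have /(same_parityP bipA _ _ CC)[ef ve vef] := parC.
have ef_mem C' : induced_cycle G C' -> (G e \in cycle_edges C') = (G f \in cycle_edges C').
  move=> IC'; have [E|NE] := pselect (cycle_edges C' =i cycle_edges C).
    by have [_ eC fC _] := parC; rewrite !E eC fC.
  by apply/idP/idP => /(others _ IC' NE).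
have Lw := cycle_vec_lattice bipA CC.
have vE v : L v -> v 0 e = v 0 f.
  move=> Lv; have := coord_proportional
    (fun u => @induced_cycles_separate _ _ _ _ bipA u _ _ ef_mem) Lv Lw.
  by rewrite -vef mulrC => /(mulfI ve).
apply: (T1_component_neq0 charK ef vE Lw ve); apply: sr.
  exists (fun k => - (k == e)%:R - (k == f)%:R).
  have delta_sum l : h G l = \sum_k h G k *~ (k == l)%:R.
    by rewrite (bigD1 l) //= eqxx big1 ?addr0 // => k /negPf->.
  rewrite {1}(delta_sum e) {1}(delta_sum f) opprD -!sumrN -big_split.
  by apply: eq_bigr => k _; rewrite mulrzBr mulrNz.
by rewrite opprK; apply: HD; apply: H_h.
Qed.

End SemiRigidity.

Local Close Scope ring_scope.

Theorem theorem6p4 (K : fieldType) (charK : ([pchar K] =i pred0)%R)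
    (m n : nat) (G : graph m n)
    (bipG : bipartite G) (insepG : inseparable G K) :
  ~ semi_rigid G K <->
  exists (e f : 'I_n) (C : seq 'I_m),
    [/\ induced_cycle G C,
        same_parity C (G e) (G f)
      & forall C' : seq 'I_m, induced_cycle G C' ->
          ~ (cycle_edges C' =i cycle_edges C) ->
          (G e \in cycle_edges C' <-> G f \in cycle_edges C')].
Proof.
have [A bipA] := bipG; split=> [nsr|[e [f [C [IC parC others]]]]]; last first.
  exact: (semi_rigid_no_edges charK bipA IC parC others).
have [e [f [[C IC parC] ef]]] := not_semi_rigid_edges charK bipA insepG nsr.
exists e, f, C; split=> // C' [CC' _] _.
by rewrite ef.
Qed.
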